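(* Let $\mathbb{T}$ be a time scale, $a,b\in\mathbb{T}$, $\mathbb{T}_\ast=[a,b]_{\mathbb{T}}$. Suppose that $u(t)$ is a nonnegative rd-continuous function on $\mathbb{T}_\ast$ and that $h(t),f(t)$ are nonnegative rd-continuous functions on $\mathbb{T}_\ast^\kappa$. Let $b(t)$ be a nonnegative rd-continuous function, not identically zero on $\mathbb{T}_\ast^{\kappa^2}$. Let $\Phi\in C(\mathbb{R}^+_0,\mathbb{R}^+_0)$ be nondecreasing, subadditive and submultiplicative with $\Phi(x)>0$ for $x>0$, let $W\in C(\mathbb{R}^+_0,\mathbb{R}^+_0)$ be nondecreasing with $W(x)>0$ for $x>0$, and let $a(t)$ be a positive, rd-continuous and nondecreasing function on $\mathbb{T}_\ast$. If $$u(t)\le a(t)+\int_a^tf(s)u(s)\Delta s+\int_a^tf(s)h(s)W\left(\int_a^sb(\tau)\Phi(u(\tau))\Delta\tau\right)\Delta s$$ for $a\le\tau\le s\le t\le b$, $\tau,s,t\in\mathbb{T}_\ast$, then for all $t\in\mathbb{T}_\ast$ satisfying $$\Psi(\xi)+\int_a^{\rho(t)}b(\tau)\Phi(p(\tau))\Phi\left(\int_a^\tau f(\theta)h(\theta)\Delta\theta\right)\Delta\tau\in\operatorname{Dom}(\Psi^{-1})$$ we have $$u(t)\le p(t)a(t)+p(t)\int_a^tf(s)h(s)W\left[\Psi^{-1}\left(\Psi(\xi)+\int_a^sb(\tau)\Phi(p(\tau))\Phi\left(\int_a^\tau f(\theta)h(\theta)\Delta\theta\right)\Delta\tau\right)\right]\Delta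 s,$$ where $$p(t)=1+\int_a^tf(s)e_f(t,\sigma(s))\Delta s,\qquad \Psi(x)=\int_{x_0}^x\frac{1}{\Phi(W(s))}ds,\ x>0,\ x_0>0,$$ $$\xi=\int_a^{\rho(b)}b(s)\Phi(p(s)a(s))\Delta s,$$ and $\Psi^{-1}$ is the inverse of $\Psi$.
   Context: $\mathbb{R}^+_0=[0,\infty)$. A time scale is a nonempty closed subset of $\mathbb{R}$; $[a,b]_{\mathbb{T}}=[a,b]\cap\mathbb{T}$; $\sigma(t)=\inf\{s\in\mathbb{T}:s>t\}$, $\rho(t)=\sup\{s\in\mathbb{T}:s<t\}$, $\mu(t)=\sigma(t)-t$. A superscript $\kappa$ removes the maximum if it is left-scattered ($\rho(t)<t$); $\kappa^2$ means twice. $f^\Delta$ is the $\Delta$-derivative (for each $\varepsilon>0$, $|f(\sigma(t))-f(s)-f^\Delta(t)(\sigma(t)-s)|\le\varepsilon|\sigma(t)-s|$ near $t$). rd-continuous: continuous at right-dense points ($\sigma(t)=t$), with finite left limits at left-dense points ($\rho(t)=t$). $\int_c^d f\Delta t=F(d)-F(c)$ with $F^\Delta=f$. For rd-continuous $q$ with $1+\mu(t)q(t)\ne0$ for all $t$, $e_q(\cdot,t_0)$ is the unique solution of $y^\Delta=q(t)y$, $y(t_0)=1$. The functions $a(t)$, $b(t)$ are distinct from the endpoints $a$, $b$. *)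

(* Defs.v *)
(* Classical real numbers of the standard library, with Coquelicot. *)
From Stdlib Require Import Reals ClassicalEpsilon.
From Coquelicot Require Import Coquelicot.

Open Scope R_scope.

(* Subsets of R are predicates; functions on a time scale are total functions
   R -> R of which only the values on the relevant domain matter. *)

Definition time_scale (T : R -> Prop) : Prop := (exists t, T t) /\ closed T.

Definition ts_itv (T : R -> Prop) (a b : R) : R -> Prop :=
  fun t => T t /\ a <= t <= b.

(* Convention: inf of the empty set is sup T, so that max T is a fixed point. *)
Definition ts_sigma (T : R -> Prop) (t : R) : R :=
  if excluded_middle_informative (exists s, T s /\ t < s)
  then real (Glb_Rbar (fun s => T s /\ t < s))
  else real (Lub_Rbar T).

(* Convention: sup of the empty set is inf T, so that min T is a fixed point. *)
Definition ts_rho (T : R -> Prop) (t : R) : R :=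
  if excluded_middle_informative (exists s, T s /\ s < t)
  then real (Lub_Rbar (fun s => T s /\ s < t))
  else real (Glb_Rbar T).

Definition kappa (T : R -> Prop) : R -> Prop :=
  fun t => T t /\ ~ ((forall s, T s -> s <= t) /\ ts_rho T t < t).

Definition is_delta_derive (T : R -> Prop) (F : R -> R) (t l : R) : Prop :=
  forall eps : R, 0 < eps ->
    within T (locally t) (fun s =>
      Rabs (F (ts_sigma T t) - F s - l * (ts_sigma T t - s))
        <= eps * Rabs (ts_sigma T t - s)).

(* D is a subset of T on which g is defined; right-dense and left-dense refer
   to T, limits are taken along D.  At t = min T the left-limit clause is
   vacuous. *)
Definition rd_continuous (T D : R -> Prop) (g : R -> R) : Prop :=
  forall t, D t ->
    (ts_sigma T t = t -> filterlim g (within D (locally t)) (locally (g t))) /\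
    (ts_rho T t = t ->
       exists l : R,
         filterlim g (within (fun s => D s /\ s < t) (locally t)) (locally l)).

(* F is an antiderivative of g between c and d: F^Delta = g on [c,d)_T and F is
   continuous on [c,d]_T.  The equation is not imposed at d (nor outside
   [c,d)_T): the integral does not depend on g there, and g need not be defined
   there.  When F^Delta = g on the whole of T^kappa, F qualifies. *)
Definition is_delta_antiderivative
    (T : R -> Prop) (g : R -> R) (c d : R) (F : R -> R) : Prop :=
  (forall t, T t -> Rmin c d <= t < Rmax c d -> is_delta_derive T F t (g t)) /\
  continuous_on (ts_itv T (Rmin c d) (Rmax c d)) F.

(* Unspecified value if there is no antiderivative. *)
Definition delta_int (T : R -> Prop) (g : R -> R) (c d : R) : R :=
  epsilon (inhabits 0) (fun v =>
    exists F, is_delta_antiderivative T g c d F /\ v = F d - F c).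

(* [delta_exp T q t t0] is e_q(t, t0), for t and t0 in T. *)
Definition delta_exp (T : R -> Prop) (q : R -> R) (t t0 : R) : R :=
  epsilon (inhabits (fun _ : R => 0)) (fun y =>
    (forall s, kappa T s -> is_delta_derive T y s (q s * y s)) /\ y t0 = 1) t.

(* To be used for x > 0 and x0 > 0. *)
Definition Psi (Phi W : R -> R) (x0 x : R) : R :=
  RInt (fun s => 1 / Phi (W s)) x0 x.

(* Psi is a function on (0,oo), so the domain of its inverse is the image of
   (0,oo). *)
Definition dom_Psi_inv (Phi W : R -> R) (x0 v : R) : Prop :=
  exists x, 0 < x /\ Psi Phi W x0 x = v.

Definition Psi_inv (Phi W : R -> R) (x0 v : R) : R :=
  epsilon (inhabits 0) (fun x => 0 < x /\ Psi Phi W x0 x = v).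

(* Main.v *)
Require Import Defs.
From Stdlib Require Import Reals.
From Coquelicot Require Import Coquelicot.
From Stdlib Require Import Lra Classical ClassicalEpsilon Ranalysis5.

Open Scope R_scope.

(** Write [v s] for the integral of [b Phi(u)] from [a] to [s], and [z t] for the
    integral of [f h W(v)] from [a] to [t].  The function [p] is the exponential
    [e_f(., a)]: the integrand of [p t - 1] is the derivative of
    [s |-> - e_f(t, s)] (lemma [delta_int_exp]).  Since [a + z] is nondecreasing,
    the inequality of Gronwall ([gronwall]) gives [u <= p (a + z)].

    Inserting this in [v] and using that [Phi] is subadditive and submultiplicative
    and that [z s <= W(v s) * int_a^s f h], one gets
      [v s <= xi + int_a^s B Phi(W(v))],  [B = b Phi(p) Phi(int_a f h)].
    If [r] is the right-hand side, the derivative of [Psi(r)] is at most [B],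
    because [Psi' = 1 / Phi(W)] is positive and nonincreasing.  So
    [Psi(r s) <= Psi(xi) + int_a^s B], that is, [v s] is at most the value of
    [Psi^-1] there ([bihari]); with this in [z], the bound [u <= p (a + z)] is the
    conclusion.

    If [xi = 0], which happens when [b] vanishes before [rho(b)], the transform is
    not available, but then [v] vanishes and the bound on [v] is immediate.

    The calculus behind this rests on three tools.  An induction principle along
    closed sets ([ts_induction]) yields that nonnegative derivatives mean
    nondecreasing functions ([delta_derive_nonneg_le]), and hence uniqueness of
    antiderivatives and of the exponential.  Carathéodory's form of the delta
    derivative ([delta_derive_iff]) yields the rules of differentiation.
    Antiderivatives are Riemann integrals of the extension by constants over the
    gaps ([antiderivative_exists]); these exist because regulated functions are
    Riemann integrable ([regulated_ex_RInt]).  The exponential function is the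
    exponential of such an antiderivative ([delta_exp_exists]). *)

(** * Limits along a subset of the line *)

Definition lim_along (D : R -> Prop) (t : R) (f : R -> R) (l : R) : Prop :=
  filterlim f (within D (locally t)) (locally l).

Lemma lim_along_iff D t f l :
  lim_along D t f l <->
  forall eps, 0 < eps -> exists d, 0 < d /\
    forall s, D s -> Rabs (s - t) < d -> Rabs (f s - l) < eps.
Proof.
  unfold lim_along; rewrite filterlim_locally; split.
  - intros H eps Heps.
    destruct (H (mkposreal eps Heps)) as [d Hd].
    exists d; split; [apply cond_pos|].
    intros s Ds Hs; exact (Hd s Hs Ds).
  - intros H eps.
    destruct (H eps (cond_pos eps)) as [d [Hd Hf]].
    exists (mkposreal d Hd); intros s Hs Ds; exact (Hf s Ds Hs).
Qed.

Lemma lim_along_ext D t f g l :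
  (forall s, D s -> f s = g s) -> lim_along D t f l -> lim_along D t g l.
Proof.
  intros Hfg; rewrite !lim_along_iff; intros H eps Heps.
  destruct (H eps Heps) as [d [Hd Hf]]; exists d; split; [exact Hd|].
  intros s Ds Hs; rewrite <- Hfg by exact Ds; auto.
Qed.

Lemma lim_along_sub D D' t f l :
  locally t (fun s => D' s -> D s) -> lim_along D t f l -> lim_along D' t f l.
Proof.
  intros [r Hr]; rewrite !lim_along_iff; intros H eps Heps.
  destruct (H eps Heps) as [d [Hd Hf]].
  exists (Rmin d r); split; [apply Rmin_pos; [exact Hd|apply cond_pos]|].
  intros s Ds Hs.
  apply Hf.
  - apply Hr; [|exact Ds].
    apply Rlt_le_trans with (1 := Hs), Rmin_r.
  - apply Rlt_le_trans with (1 := Hs), Rmin_l.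
Qed.

Lemma lim_along_subset (D D' : R -> Prop) t f l :
  (forall s, D' s -> D s) -> lim_along D t f l -> lim_along D' t f l.
Proof.
  intros H; apply lim_along_sub, filter_forall; exact H.
Qed.

Lemma lim_along_const D t c : lim_along D t (fun _ => c) c.
Proof. apply filterlim_const. Qed.

Lemma lim_along_id D t : lim_along D t (fun s => s) t.
Proof.
  apply lim_along_iff; intros eps Heps; exists eps; auto.
Qed.

Lemma lim_along_comp D t f l g :
  continuous g l -> lim_along D t f l -> lim_along D t (fun s => g (f s)) (g l).
Proof. intros Hg Hf; exact (filterlim_comp _ _ _ _ _ _ _ _ Hf Hg). Qed.

Lemma lim_along_plus D t f g l m :
  lim_along D t f l -> lim_along D t g m ->
  lim_along D t (fun s => f s + g s) (l + m).
Proof.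
  intros Hf Hg.
  exact (filterlim_comp_2 _ _ _ Hf Hg (filterlim_plus (V := R_NormedModule) l m)).
Qed.

Lemma lim_along_mult D t f g l m :
  lim_along D t f l -> lim_along D t g m ->
  lim_along D t (fun s => f s * g s) (l * m).
Proof.
  intros Hf Hg.
  exact (filterlim_comp_2 _ _ _ Hf Hg (filterlim_mult (K := R_AbsRing) l m)).
Qed.

Lemma lim_along_opp D t f l :
  lim_along D t f l -> lim_along D t (fun s => - f s) (- l).
Proof.
  apply (lim_along_comp D t f l Ropp).
  apply (continuous_opp (fun x : R => x) l), continuous_id.
Qed.

Lemma lim_along_minus D t f g l m :
  lim_along D t f l -> lim_along D t g m ->
  lim_along D t (fun s => f s - g s) (l - m).
Proof.
  intros Hf Hg; apply lim_along_plus; [exact Hf|]; apply lim_along_opp, Hg.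
Qed.

Lemma lim_along_inv D t f l :
  l <> 0 -> lim_along D t f l -> lim_along D t (fun s => / f s) (/ l).
Proof.
  intros Hl; apply (lim_along_comp D t f l Rinv).
  apply continuous_Rinv, Hl.
Qed.

(** * Order structure of a compact time scale *)

Definition compact_ts (T : R -> Prop) (a b : R) : Prop :=
  closed T /\ T a /\ T b /\ forall t, T t -> a <= t <= b.

Lemma closed_adherent (T : R -> Prop) m :
  closed T ->
  (forall eps, 0 < eps -> exists s, T s /\ Rabs (s - m) < eps) -> T m.
Proof.
  intros Hc H; apply Hc; intros [e He].
  destruct (H e (cond_pos e)) as [s [Ts Hs]].
  exact (He s Hs Ts).
Qed.

Lemma Lub_real (E : R -> Prop) M :
  (exists s, E s) -> (forall s, E s -> s <= M) ->
  (forall s, E s -> s <= real (Lub_Rbar E)) /\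
  (forall N, (forall s, E s -> s <= N) -> real (Lub_Rbar E) <= N).
Proof.
  intros [s0 E0] HM.
  destruct (Lub_Rbar_correct E) as [Hub Hlub].
  assert (HM' := Hlub (Finite M) HM).
  assert (H0 := Hub s0 E0).
  destruct (Lub_Rbar E) as [m| |]; simpl in HM', H0; try contradiction.
  split; [exact Hub|].
  intros N HN; exact (Hlub (Finite N) HN).
Qed.

Lemma Glb_real (E : R -> Prop) M :
  (exists s, E s) -> (forall s, E s -> M <= s) ->
  (forall s, E s -> real (Glb_Rbar E) <= s) /\
  (forall N, (forall s, E s -> N <= s) -> N <= real (Glb_Rbar E)).
Proof.
  intros [s0 E0] HM.
  destruct (Glb_Rbar_correct E) as [Hub Hlub].
  assert (HM' := Hlub (Finite M) HM).
  assert (H0 := Hub s0 E0).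
  destruct (Glb_Rbar E) as [m| |]; simpl in HM', H0; try contradiction.
  split; [exact Hub|].
  intros N HN; exact (Hlub (Finite N) HN).
Qed.

Lemma sup_approx (E : R -> Prop) m eps :
  (forall N, (forall s, E s -> s <= N) -> m <= N) -> 0 < eps ->
  exists s, E s /\ m - eps < s.
Proof.
  intros H Heps; apply NNPP; intros Hn.
  assert (m <= m - eps); [|lra].
  apply H; intros s Es.
  destruct (Rle_dec s (m - eps)) as [h|h]; [exact h|].
  exfalso; apply Hn; exists s; split; [exact Es|lra].
Qed.

Lemma inf_approx (E : R -> Prop) m eps :
  (forall N, (forall s, E s -> N <= s) -> N <= m) -> 0 < eps ->
  exists s, E s /\ s < m + eps.
Proof.
  intros H Heps; apply NNPP; intros Hn.
  assert (m + eps <= m); [|lra].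
  apply H; intros s Es.
  destruct (Rle_dec (m + eps) s) as [h|h]; [exact h|].
  exfalso; apply Hn; exists s; split; [exact Es|lra].
Qed.

Lemma closed_sup (T E : R -> Prop) M :
  closed T -> (forall s, E s -> T s) ->
  (exists s, E s) -> (forall s, E s -> s <= M) ->
  T (real (Lub_Rbar E)).
Proof.
  intros Hc HE Hne HM.
  destruct (Lub_real E M Hne HM) as [H1 H2].
  apply closed_adherent; [exact Hc|]; intros eps Heps.
  destruct (sup_approx E _ eps H2 Heps) as [s [Es Hs]].
  exists s; split; [auto|].
  specialize (H1 s Es); apply Rabs_def1; lra.
Qed.

Lemma closed_inf (T E : R -> Prop) M :
  closed T -> (forall s, E s -> T s) ->
  (exists s, E s) -> (forall s, E s -> M <= s) ->
  T (real (Glb_Rbar E)).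
Proof.
  intros Hc HE Hne HM.
  destruct (Glb_real E M Hne HM) as [H1 H2].
  apply closed_adherent; [exact Hc|]; intros eps Heps.
  destruct (inf_approx E _ eps H2 Heps) as [s [Es Hs]].
  exists s; split; [auto|].
  specialize (H1 s Es); apply Rabs_def1; lra.
Qed.

Lemma sigma_spec T a b t :
  compact_ts T a b -> T t ->
  T (ts_sigma T t) /\ t <= ts_sigma T t /\
  (forall s, T s -> t < s -> ts_sigma T t <= s).
Proof.
  intros [Hc [Ta [Tb Hab]]] Tt; unfold ts_sigma.
  destruct (excluded_middle_informative _) as [Hex|Hn].
  - assert (HM : forall s, T s /\ t < s -> t <= s) by (intros; lra).
    destruct (Glb_real _ t Hex HM) as [H1 H2].
    split; [|split].
    + apply (closed_inf T _ t); auto; tauto.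
    + apply H2, HM.
    + intros; apply H1; auto.
  - assert (Hm : forall s, T s -> s <= t).
    { intros s Ts; destruct (Rle_dec s t) as [h|h]; [exact h|].
      exfalso; apply Hn; exists s; split; [exact Ts|lra]. }
    destruct (Lub_real T t (ex_intro _ t Tt) Hm) as [H1 H2].
    assert (E : real (Lub_Rbar T) = t).
    { apply Rle_antisym; [apply H2, Hm|apply H1, Tt]. }
    rewrite E; split; [exact Tt|split; [lra|]].
    intros s Ts Hs; specialize (Hm s Ts); lra.
Qed.

Lemma right_dense_approx T a b t eps :
  compact_ts T a b -> T t -> ts_sigma T t = t -> t < b -> 0 < eps ->
  exists s, T s /\ t < s < t + eps.
Proof.
  intros [Hc [Ta [Tb Hab]]] Tt Hs Htb Heps; revert Hs; unfold ts_sigma.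
  destruct (excluded_middle_informative _) as [Hex|Hn].
  - intros E.
    assert (HM : forall s, T s /\ t < s -> t <= s) by (intros; lra).
    destruct (Glb_real _ t Hex HM) as [H1 H2].
    rewrite E in H2.
    destruct (inf_approx _ _ eps H2 Heps) as [s [[Ts Hs1] Hs2]].
    exists s; repeat split; auto.
  - exfalso; apply Hn; exists b; auto.
Qed.

Lemma sigma_max T a b : compact_ts T a b -> ts_sigma T b = b.
Proof.
  intros HT; destruct (sigma_spec T a b b HT) as [H1 [H2 _]].
  - apply HT.
  - destruct HT as [_ [_ [_ Hab]]]; specialize (Hab _ H1); lra.
Qed.

Lemma rho_spec T a b t :
  compact_ts T a b -> T t ->
  T (ts_rho T t) /\ ts_rho T t <= t /\
  (forall s, T s -> s < t -> s <= ts_rho T t).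
Proof.
  intros [Hc [Ta [Tb Hab]]] Tt; unfold ts_rho.
  destruct (excluded_middle_informative _) as [Hex|Hn].
  - assert (HM : forall s, T s /\ s < t -> s <= t) by (intros; lra).
    destruct (Lub_real _ t Hex HM) as [H1 H2].
    split; [|split].
    + apply (closed_sup T _ t); auto; tauto.
    + apply H2, HM.
    + intros; apply H1; auto.
  - assert (Hm : forall s, T s -> t <= s).
    { intros s Ts; destruct (Rle_dec t s) as [h|h]; [exact h|].
      exfalso; apply Hn; exists s; split; [exact Ts|lra]. }
    destruct (Glb_real T t (ex_intro _ t Tt) Hm) as [H1 H2].
    assert (E : real (Glb_Rbar T) = t).
    { apply Rle_antisym; [apply H1, Tt|apply H2, Hm]. }
    rewrite E; split; [exact Tt|split; [lra|]].
    intros s Ts Hs; specialize (Hm s Ts); lra.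
Qed.

Definition ts_floor (T : R -> Prop) (x : R) : R :=
  real (Lub_Rbar (fun s => T s /\ s <= x)).

Lemma floor_spec T a b x :
  compact_ts T a b -> a <= x ->
  T (ts_floor T x) /\ ts_floor T x <= x /\
  (forall s, T s -> s <= x -> s <= ts_floor T x).
Proof.
  intros [Hc [Ta [Tb Hab]]] Hx; unfold ts_floor.
  assert (Hex : exists s, T s /\ s <= x) by (exists a; auto).
  assert (HM : forall s, T s /\ s <= x -> s <= x) by tauto.
  destruct (Lub_real _ x Hex HM) as [H1 H2].
  split; [|split].
  - apply (closed_sup T _ x); auto; tauto.
  - apply H2, HM.
  - intros; apply H1; auto.
Qed.

Lemma floor_unique T a b x t :
  compact_ts T a b -> T t -> t <= x -> (forall s, T s -> s <= x -> s <= t) ->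
  ts_floor T x = t.
Proof.
  intros HT Tt Htx Hmax.
  assert (Hax : a <= x) by (destruct HT as [_ [_ [_ h]]]; specialize (h t Tt); lra).
  destruct (floor_spec T a b x HT Hax) as [H1 [H2 H3]].
  apply Rle_antisym; auto.
Qed.

(** Induction along a time scale: the supremum of the points up to which [P]
    holds satisfies [P] itself (it is reached, or it is a limit from the left),
    and it cannot lie before [d], as [P] crosses gaps and spreads to the right of
    right-dense points.  Gaps and density are expressed without the jump
    operators, so that the principle applies to the whole real line as well. *)
Lemma ts_induction (T : R -> Prop) c d (P : R -> Prop) :
  closed T -> T c -> T d -> c <= d ->
  P c ->
  (forall t s, T t -> T s -> c <= t < s -> s <= d ->
     (forall r, T r -> r < s -> r <= t) -> P t -> P s) ->
  (forall t, T t -> c <= t < d ->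
     (forall eps, 0 < eps -> exists s, T s /\ t < s < t + eps) -> P t ->
     exists e, 0 < e /\ forall s, T s -> t < s < t + e -> s <= d -> P s) ->
  (forall t, T t -> c < t <= d ->
     (forall eps, 0 < eps -> exists s, T s /\ t - eps < s < t) ->
     (forall s, T s -> c <= s < t -> P s) -> P t) ->
  P d.
Proof.
  intros Hc Tc Td Hcd Pc Hjump Hright Hleft.
  set (S := fun x => T x /\ c <= x <= d /\ forall s, T s -> c <= s <= x -> P s).
  assert (Sc : S c).
  { split; [exact Tc|split; [lra|]].
    intros s _ Hs; replace s with c by lra; exact Pc. }
  assert (HSd : forall s, S s -> s <= d) by (intros s [_ [h _]]; lra).
  destruct (Lub_real S d (ex_intro _ c Sc) HSd) as [H1 H2].
  assert (Tm : T (real (Lub_Rbar S))).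
  { apply (closed_sup T S d); auto; [intros s [h _]; exact h|exists c; exact Sc]. }
  set (m := real (Lub_Rbar S)) in *.
  assert (Hcm : c <= m) by (apply H1, Sc).
  assert (Hmd : m <= d) by (apply H2, HSd).
  assert (Hbelow : forall s, T s -> c <= s < m -> P s).
  { intros s Ts Hs.
    destruct (sup_approx S m (m - s) H2) as [x [[_ [_ Sx]] Hx]]; [lra|].
    apply Sx; [exact Ts|lra]. }
  assert (Pm : P m).
  { destruct (Rle_lt_or_eq_dec c m Hcm) as [Hlt|Heq]; [|rewrite <- Heq; exact Pc].
    destruct (classic (forall eps, 0 < eps -> exists s, T s /\ m - eps < s < m))
      as [Hd|Hnd]; [apply Hleft; auto; lra|].
    apply not_all_ex_not in Hnd; destruct Hnd as [eps Hnd].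
    apply imply_to_and in Hnd; destruct Hnd as [Heps Hnd].
    destruct (sup_approx S m eps H2 Heps) as [x [Sx Hx]].
    assert (Hxm := H1 x Sx).
    destruct (Rle_lt_or_eq_dec x m Hxm) as [h|h].
    - exfalso; apply Hnd; exists x; split; [apply Sx|lra].
    - rewrite <- h; destruct Sx as [Tx [hx Sx]]; apply Sx; [exact Tx|lra]. }
  assert (Sm : forall s, T s -> c <= s <= m -> P s).
  { intros s Ts Hs; destruct (Rle_lt_or_eq_dec s m) as [h|h]; [lra| |].
    - apply Hbelow; auto; lra.
    - rewrite h; exact Pm. }
  destruct (Rle_lt_or_eq_dec m d Hmd) as [Hlt|Heq]; [exfalso|rewrite <- Heq; exact Pm].
  destruct (classic (forall eps, 0 < eps -> exists s, T s /\ m < s < m + eps))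
      as [Hd|Hnd].
  - destruct (Hright m Tm (conj Hcm Hlt) Hd Pm) as [e [He Hs]].
    destruct (Hd (Rmin e (d - m))) as [s [Ts Hms]]; [apply Rmin_pos; lra|].
    assert (h1 := Rmin_l e (d - m)); assert (h2 := Rmin_r e (d - m)).
    assert (s <= m); [|lra].
    apply H1; split; [exact Ts|split; [lra|]].
    intros r Tr Hr; destruct (Rle_dec r m) as [h|h]; [apply Sm; auto; lra|].
    apply Hs; auto; lra.
  - apply not_all_ex_not in Hnd; destruct Hnd as [eps Hnd].
    apply imply_to_and in Hnd; destruct Hnd as [Heps Hnd].
    set (E := fun s => T s /\ m < s).
    assert (HE : exists s, E s) by (exists d; split; auto).
    assert (HEm : forall s, E s -> m + eps <= s).
    { intros s [Ts Hs]; destruct (Rle_dec (m + eps) s) as [h|h]; [exact h|].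
      exfalso; apply Hnd; exists s; split; [exact Ts|lra]. }
    destruct (Glb_real E _ HE HEm) as [G1 G2].
    assert (Tn : T (real (Glb_Rbar E))).
    { apply (closed_inf T E (m + eps)); auto; intros s h; apply h. }
    set (n := real (Glb_Rbar E)) in *.
    assert (Hn : m + eps <= n) by (apply G2, HEm).
    assert (Hnd' : n <= d) by (apply G1; split; auto).
    assert (Hgap : forall r, T r -> r < n -> r <= m).
    { intros r Tr Hr; destruct (Rle_dec r m) as [h|h]; [exact h|].
      assert (n <= r); [apply G1; split; [exact Tr|lra]|lra]. }
    assert (Pn : P n) by (apply (Hjump m n); auto; lra).
    assert (n <= m); [|lra].
    apply H1; split; [exact Tn|split; [lra|]].
    intros r Tr Hr; destruct (Rle_lt_or_eq_dec r n) as [h|h]; [lra| |].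
    + apply Sm; [exact Tr|split; [lra|apply Hgap; auto]].
    + rewrite h; exact Pn.
Qed.

(** * The delta derivative *)

(** Carathéodory's form of differentiability: the difference quotient extends
    continuously to [t].  It treats right-scattered and right-dense points
    alike, so the rules of differentiation reduce to rules for limits.  At a
    right-scattered [t] the estimate at [s = t] holds for every [eps] and is
    therefore an equality. *)
Lemma delta_derive_iff T a b F t l :
  compact_ts T a b -> T t ->
  is_delta_derive T F t l <->
  exists phi, lim_along T t phi l /\ phi t = l /\
    forall s, T s -> F (ts_sigma T t) - F s = phi s * (ts_sigma T t - s).
Proof.
  intros HT Tt.
  destruct (sigma_spec T a b t HT Tt) as [Tsig [Hle _]].
  set (st := ts_sigma T t) in *.
  split.
  - intros H.
    set (phi := fun s => if Req_EM_T s st then l else (F st - F s) / (st - s)).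
    exists phi; split; [|split].
    + apply lim_along_iff; intros eps Heps.
      destruct (H (eps / 2)) as [d Hd]; [lra|].
      exists d; split; [apply cond_pos|]; intros s Ts Hs; unfold phi.
      destruct (Req_EM_T s st) as [e|ne].
      * rewrite Rminus_diag, Rabs_R0; exact Heps.
      * specialize (Hd s Hs Ts); fold st in Hd.
        assert (Hn : 0 < Rabs (st - s)) by (apply Rabs_pos_lt; lra).
        replace ((F st - F s) / (st - s) - l)
          with ((F st - F s - l * (st - s)) / (st - s)) by (field; lra).
        unfold Rdiv at 1; rewrite Rabs_mult, Rabs_inv.
        apply (Rmult_lt_reg_r (Rabs (st - s))); [exact Hn|].
        rewrite Rmult_assoc, Rinv_l, Rmult_1_r by lra.
        nra.
    + unfold phi; destruct (Req_EM_T t st) as [e|ne]; [reflexivity|].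
      assert (Hz : F st - F t - l * (st - t) = 0).
      { apply NNPP; intros Hnz.
        assert (Hn := Rabs_pos_lt _ Hnz).
        set (A := Rabs (F st - F t - l * (st - t))) in *.
        destruct (H (A / (2 * (st - t)))) as [d Hd].
        { apply Rdiv_lt_0_compat; lra. }
        assert (Ht := Hd t (ball_center t d) Tt).
        fold st in Ht; fold A in Ht.
        rewrite (Rabs_pos_eq (st - t)) in Ht by lra.
        replace (A / (2 * (st - t)) * (st - t)) with (A / 2) in Ht by (field; lra).
        lra. }
      apply (Rmult_eq_reg_r (st - t)); [|lra].
      unfold Rdiv; rewrite Rmult_assoc, Rinv_l by lra; lra.
    + intros s Ts; unfold phi; destruct (Req_EM_T s st) as [e|ne].
      * rewrite e; ring.
      * field; lra.
  - intros [phi [Hlim [Hphi Heq]]] eps Heps.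
    destruct (proj1 (lim_along_iff _ _ _ _) Hlim eps Heps) as [d [Hd Hs]].
    exists (mkposreal d Hd); intros s Hb Ts; fold st.
    rewrite Heq by exact Ts.
    rewrite <- Rmult_minus_distr_r, Rabs_mult.
    apply Rmult_le_compat_r; [apply Rabs_pos|].
    left; exact (Hs s Ts Hb).
Qed.

Lemma delta_derive_cont T a b F t l :
  compact_ts T a b -> T t -> is_delta_derive T F t l -> lim_along T t F (F t).
Proof.
  intros HT Tt H.
  apply (delta_derive_iff T a b F t l HT Tt) in H.
  destruct H as [phi [Hlim [Hphi Heq]]].
  assert (Ht := Heq t Tt); rewrite Hphi in Ht.
  replace (F t) with (F (ts_sigma T t) - l * (ts_sigma T t - t)) by lra.
  apply (lim_along_ext T t (fun s => F (ts_sigma T t) - phi s * (ts_sigma T t - s))).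
  - intros s Ts; specialize (Heq s Ts); lra.
  - apply lim_along_minus; [apply lim_along_const|].
    apply lim_along_mult; [exact Hlim|].
    apply lim_along_minus; [apply lim_along_const|apply lim_along_id].
Qed.

Lemma delta_derive_sigma T a b F t l :
  compact_ts T a b -> T t -> is_delta_derive T F t l ->
  F (ts_sigma T t) = F t + l * (ts_sigma T t - t).
Proof.
  intros HT Tt H.
  apply (delta_derive_iff T a b F t l HT Tt) in H.
  destruct H as [phi [Hlim [Hphi Heq]]].
  assert (Ht := Heq t Tt); rewrite Hphi in Ht; lra.
Qed.

Lemma delta_derive_ext_loc T F G t l :
  locally t (fun s => T s -> F s = G s) -> F (ts_sigma T t) = G (ts_sigma T t) ->
  is_delta_derive T F t l -> is_delta_derive T G t l.
Proof.
  intros Hloc Hs H eps Heps.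
  specialize (H eps Heps).
  unfold within in *.
  generalize (filter_and _ _ Hloc H); apply filter_imp.
  intros s [E1 E2] Ts; rewrite <- Hs, <- (E1 Ts); auto.
Qed.

Lemma delta_derive_scattered T a b F t :
  compact_ts T a b -> T t -> t < ts_sigma T t -> lim_along T t F (F t) ->
  is_delta_derive T F t ((F (ts_sigma T t) - F t) / (ts_sigma T t - t)).
Proof.
  intros HT Tt Hlt Hc.
  apply (delta_derive_iff T a b _ _ _ HT Tt).
  set (st := ts_sigma T t) in *.
  exists (fun s => if Req_EM_T s st then 0 else (F st - F s) / (st - s)).
  split; [|split].
  - apply (lim_along_sub (fun s => T s /\ s <> st)).
    { exists (mkposreal (st - t) ltac:(lra)); intros s Hs Ts; split; [exact Ts|].
      apply Rabs_def2 in Hs; unfold minus, plus, opp in Hs; simpl in Hs; lra. }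
    apply (lim_along_ext _ _ (fun s => (F st - F s) * / (st - s))).
    { intros s [_ Hs]; destruct (Req_EM_T s st); [contradiction|reflexivity]. }
    apply (lim_along_subset T); [tauto|].
    apply lim_along_mult; [|apply lim_along_inv; [lra|]];
      apply lim_along_minus; auto using lim_along_const, lim_along_id.
  - destruct (Req_EM_T t st); [lra|reflexivity].
  - intros s Ts; destruct (Req_EM_T s st) as [e|ne]; [rewrite e; ring|field; lra].
Qed.

Lemma delta_derive_const T a b t c :
  compact_ts T a b -> T t -> is_delta_derive T (fun _ => c) t 0.
Proof.
  intros HT Tt; apply (delta_derive_iff T a b _ _ _ HT Tt).
  exists (fun _ => 0); split; [apply lim_along_const|split; [reflexivity|]].
  intros; ring.
Qed.

Lemma delta_derive_plus T a b F G t l m :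
  compact_ts T a b -> T t ->
  is_delta_derive T F t l -> is_delta_derive T G t m ->
  is_delta_derive T (fun s => F s + G s) t (l + m).
Proof.
  intros HT Tt; rewrite !(delta_derive_iff T a b _ _ _ HT Tt).
  intros [phi [H1 [H2 H3]]] [psi [K1 [K2 K3]]].
  exists (fun s => phi s + psi s); split; [|split].
  - apply lim_along_plus; auto.
  - congruence.
  - intros s Ts; specialize (H3 s Ts); specialize (K3 s Ts); lra.
Qed.

Lemma delta_derive_scal T a b F t l c :
  compact_ts T a b -> T t ->
  is_delta_derive T F t l -> is_delta_derive T (fun s => c * F s) t (c * l).
Proof.
  intros HT Tt; rewrite !(delta_derive_iff T a b _ _ _ HT Tt).
  intros [phi [H1 [H2 H3]]].
  exists (fun s => c * phi s); split; [|split].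
  - apply lim_along_mult; auto using lim_along_const.
  - congruence.
  - intros s Ts; rewrite <- Rmult_minus_distr_l, H3 by exact Ts; ring.
Qed.

Lemma delta_derive_minus T a b F G t l m :
  compact_ts T a b -> T t ->
  is_delta_derive T F t l -> is_delta_derive T G t m ->
  is_delta_derive T (fun s => F s - G s) t (l - m).
Proof.
  intros HT Tt; rewrite !(delta_derive_iff T a b _ _ _ HT Tt).
  intros [phi [H1 [H2 H3]]] [psi [K1 [K2 K3]]].
  exists (fun s => phi s - psi s); split; [|split].
  - apply lim_along_minus; auto.
  - congruence.
  - intros s Ts; specialize (H3 s Ts); specialize (K3 s Ts); lra.
Qed.

Lemma delta_derive_div T a b F G t l m :
  compact_ts T a b -> T t -> (forall s, T s -> 0 < G s) ->
  is_delta_derive T F t l -> is_delta_derive T G t m ->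
  is_delta_derive T (fun s => F s / G s) t
    ((l * G t - F t * m) / (G (ts_sigma T t) * G t)).
Proof.
  intros HT Tt Hpos HF HG.
  assert (CF := delta_derive_cont T a b F t l HT Tt HF).
  assert (CG := delta_derive_cont T a b G t m HT Tt HG).
  revert HF HG; rewrite !(delta_derive_iff T a b _ _ _ HT Tt).
  intros [phi [H1 [H2 H3]]] [psi [K1 [K2 K3]]].
  destruct (sigma_spec T a b t HT Tt) as [Tsig _].
  set (st := ts_sigma T t) in *.
  assert (P1 := Hpos _ Tsig); assert (P2 := Hpos _ Tt).
  exists (fun s => (phi s * G s - F s * psi s) / (G st * G s)); split; [|split].
  - apply lim_along_mult.
    + apply lim_along_minus; apply lim_along_mult; auto.
    + apply lim_along_inv; [nra|].
      apply lim_along_mult; auto using lim_along_const.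
  - rewrite H2, K2; reflexivity.
  - intros s Ts; specialize (H3 s Ts); specialize (K3 s Ts).
    assert (P3 := Hpos _ Ts).
    replace ((phi s * G s - F s * psi s) / (G st * G s) * (st - s))
      with ((phi s * (st - s) * G s - F s * (psi s * (st - s))) / (G st * G s))
      by (field; lra).
    rewrite <- H3, <- K3; field; lra.
Qed.

(** [l] stands for the derivative of [g] at [y]: it is the value that makes the
    difference quotient continuous in [x]. *)
Definition slope (g : R -> R) (l y x : R) : R :=
  if Req_EM_T x y then l else (g y - g x) / (y - x).

Lemma slope_eq g l y x : g y - g x = slope g l y x * (y - x).
Proof.
  unfold slope; destruct (Req_EM_T x y) as [e|ne]; [rewrite e; ring|field; lra].
Qed.

Lemma slope_cont g l y x :
  is_derive g y l -> continuous g x -> continuous (slope g l y) x.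
Proof.
  intros Hd Hc.
  destruct (Req_EM_T x y) as [e|ne].
  - subst x.
    apply is_derive_Reals in Hd.
    apply filterlim_locally; intros eps.
    destruct (Hd eps (cond_pos eps)) as [d Hdd].
    exists d; intros z0 Hz; pose (z := z0 : R); change z0 with z in Hz |- *; clearbody z.
    assert (Hz' : Rabs (z - y) < d) by exact Hz.
    change (Rabs (slope g l y z - slope g l y y) < eps).
    unfold slope; destruct (Req_EM_T y y) as [_|n]; [|congruence].
    destruct (Req_EM_T z y) as [e|ne].
    + rewrite Rminus_diag, Rabs_R0; apply cond_pos.
    + assert (Hh : z - y <> 0) by lra.
      specialize (Hdd (z - y) Hh Hz').
      replace (y + (z - y)) with z in Hdd by ring.
      replace ((g y - g z) / (y - z)) with ((g z - g y) / (z - y)) by (field; lra).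
      exact Hdd.
  - assert (Hpos : 0 < Rabs (x - y)) by (apply Rabs_pos_lt; lra).
    apply (continuous_ext_loc _ (fun z => (g y - g z) * / (y - z))).
    { exists (mkposreal _ Hpos); intros z Hz.
      assert (Hz' : Rabs (z - x) < Rabs (x - y)) by exact Hz.
      unfold slope; destruct (Req_EM_T z y) as [e|ne']; [|reflexivity].
      subst z; rewrite Rabs_minus_sym in Hz'; lra. }
    apply (continuous_mult (fun z => g y - g z) (fun z => / (y - z))).
    + apply (continuous_minus (fun _ => g y) g); [apply continuous_const|exact Hc].
    + apply continuous_Rinv_comp; [|lra].
      apply (continuous_minus (fun _ : R => y) (fun z => z));
        [apply continuous_const|apply continuous_id].
Qed.

(** Chain rule with a function of a real variable outside.  Across a gap its
    derivative is replaced by its mean slope. *)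
Lemma delta_derive_comp T a b F g t l m :
  compact_ts T a b -> T t ->
  is_delta_derive T F t l ->
  is_derive g (F (ts_sigma T t)) m -> continuous g (F t) ->
  is_delta_derive T (fun s => g (F s)) t (slope g m (F (ts_sigma T t)) (F t) * l).
Proof.
  intros HT Tt HF Hd Hc.
  assert (CF := delta_derive_cont T a b F t l HT Tt HF).
  revert HF; rewrite !(delta_derive_iff T a b _ _ _ HT Tt).
  intros [phi [H1 [H2 H3]]].
  exists (fun s => slope g m (F (ts_sigma T t)) (F s) * phi s); split; [|split].
  - apply lim_along_mult; [|exact H1].
    apply lim_along_comp; [|exact CF].
    apply slope_cont; auto.
  - rewrite H2; reflexivity.
  - intros s Ts; rewrite (slope_eq g m), H3 by exact Ts; ring.
Qed.

(** By induction along the time scale, [F] stays above the line of slope [-eps]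
    through its initial value; then [eps] tends to [0]. *)
Lemma delta_derive_nonneg_le T a b F l c d :
  compact_ts T a b -> T c -> T d -> c <= d ->
  (forall t, T t -> c <= t < d -> is_delta_derive T F t (l t) /\ 0 <= l t) ->
  continuous_on (ts_itv T c d) F ->
  F c <= F d.
Proof.
  intros HT Tc Td Hcd Hder Hcont.
  assert (Hline : forall eps, 0 < eps -> F c - eps * (d - c) <= F d).
  { intros eps Heps.
    apply (ts_induction T c d (fun t => F c - eps * (t - c) <= F t));
      auto; [apply HT|lra| | |].
    - intros t s Tt Ts Hts Hsd Hgap Pt.
      destruct (sigma_spec T a b t HT Tt) as [S1 [S2 S3]].
      assert (E : ts_sigma T t = s).
      { apply Rle_antisym; [apply S3; auto; lra|].
        destruct (Rle_dec s (ts_sigma T t)) as [h|h]; [exact h|].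
        assert (t = ts_sigma T t) by (apply Rle_antisym; [lra|apply Hgap; auto; lra]).
        exfalso.
        destruct (Rle_lt_or_eq_dec t b) as [hb|hb];
          [apply HT; exact Tt| |].
        - destruct (right_dense_approx T a b t (s - t) HT Tt) as [r [Tr Hr]];
            [congruence|exact hb|lra|].
          assert (r <= t) by (apply Hgap; auto; lra); lra.
        - assert (s <= b) by (apply HT; exact Ts); lra. }
      destruct (Hder t Tt) as [D1 D2]; [lra|].
      rewrite <- E; rewrite (delta_derive_sigma T a b F t (l t) HT Tt D1).
      rewrite E; nra.
    - intros t Tt Ht Hdense Pt.
      destruct (Hder t Tt) as [D1 D2]; [lra|].
      assert (E : ts_sigma T t = t).
      { destruct (sigma_spec T a b t HT Tt) as [S1 [S2 S3]].
        apply Rle_antisym; [|exact S2].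
        apply Rnot_lt_le; intros h.
        destruct (Hdense (ts_sigma T t - t)) as [s [Ts Hs]]; [lra|].
        specialize (S3 s Ts); lra. }
      destruct (D1 eps Heps) as [e He].
      exists e; split; [apply cond_pos|]; intros s Ts Hs Hsd.
      assert (Hb : ball t e s).
      { change (Rabs (s - t) < e); rewrite Rabs_pos_eq; lra. }
      specialize (He s Hb Ts); rewrite E in He.
      rewrite (Rabs_left (t - s)) in He by lra.
      apply Rabs_le_between in He; nra.
    - intros t Tt Ht Hdense Hbelow.
      apply Rnot_lt_le; intros Hlt.
      assert (Hc := Hcont t (conj Tt (conj (Rlt_le _ _ (proj1 Ht)) (proj2 Ht)))).
      apply lim_along_iff with (eps := F c - eps * (t - c) - F t) in Hc; [|lra].
      destruct Hc as [e [He Hs]].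
      destruct (Hdense (Rmin e (t - c))) as [s [Ts Hst]]; [apply Rmin_pos; lra|].
      assert (h1 := Rmin_l e (t - c)); assert (h2 := Rmin_r e (t - c)).
      assert (Hs' := Hbelow s Ts ltac:(lra)).
      assert (Hd : Rabs (F s - F t) < F c - eps * (t - c) - F t).
      { apply Hs; [split; [exact Ts|lra]|]; rewrite Rabs_left; lra. }
      apply Rabs_def2 in Hd; nra. }
  destruct (Rle_lt_or_eq_dec c d Hcd) as [Hlt|Heq]; [|rewrite Heq; lra].
  apply Rnot_lt_le; intros h.
  specialize (Hline ((F c - F d) / (2 * (d - c)))).
  replace ((F c - F d) / (2 * (d - c)) * (d - c)) with ((F c - F d) / 2) in Hline
    by (field; lra).
  assert (0 < (F c - F d) / (2 * (d - c))) by (apply Rdiv_lt_0_compat; lra).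
  lra.
Qed.

(** * Integration of regulated functions *)

Definition uniform_approx (f : R -> R) (eps a x : R) (phi : R -> R) : Prop :=
  ex_RInt phi a x /\ forall y, a <= y <= x -> Rabs (phi y - f y) < eps.

(** The pointwise value at the new end [d] is that of [f]: one point does not
    affect integrability. *)
Lemma uniform_approx_extend f eps a c d l phi :
  0 < eps -> a <= c < d ->
  (forall y, c < y < d -> Rabs (f y - l) < eps) ->
  uniform_approx f eps a c phi ->
  exists psi, uniform_approx f eps a d psi.
Proof.
  intros Heps Hacd Hl [Hex Hphi].
  exists (fun y => if Rle_dec y c then phi y
                   else if Rlt_dec y d then l else f y).
  split.
  - apply ex_RInt_Chasles with c.
    + apply (ex_RInt_ext phi); [|exact Hex].
      intros y Hy; rewrite Rmax_right in Hy by lra.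
      destruct (Rle_dec y c); [reflexivity|lra].
    + apply (ex_RInt_ext (fun _ => l)); [|apply ex_RInt_const].
      intros y Hy; rewrite Rmin_left, Rmax_right in Hy by lra.
      destruct (Rle_dec y c); [lra|]; destruct (Rlt_dec y d); [reflexivity|lra].
  - intros y Hy; destruct (Rle_dec y c); [apply Hphi; lra|].
    destruct (Rlt_dec y d).
    + rewrite Rabs_minus_sym; apply Hl; lra.
    + rewrite Rminus_diag, Rabs_R0; exact Heps.
Qed.

Lemma regulated_uniform_approx f a b eps :
  a <= b -> 0 < eps ->
  (forall x, a <= x < b -> exists l, lim_along (fun y => x < y) x f l) ->
  (forall x, a < x <= b -> exists l, lim_along (fun y => y < x) x f l) ->
  exists phi, uniform_approx f eps a b phi.
Proof.
  intros Hab Heps Hr Hl.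
  apply (ts_induction (fun _ => True) a b
           (fun x => exists phi, uniform_approx f eps a x phi));
    try exact I; auto.
  - apply closed_true.
  - exists f; split; [apply ex_RInt_point|].
    intros; rewrite Rminus_diag, Rabs_R0; exact Heps.
  - intros t s _ _ Hts _ Hgap _; exfalso.
    assert (h := Hgap ((t + s) / 2) I); lra.
  - intros t _ Ht _ [phi Hphi].
    destruct (Hr t Ht) as [l Hlim].
    destruct (proj1 (lim_along_iff _ _ _ _) Hlim eps Heps) as [d [Hd Hs]].
    exists d; split; [exact Hd|]; intros s _ Hs1 _.
    apply (uniform_approx_extend f eps a t s l phi); auto; [lra|].
    intros y Hy; apply Hs; [lra|]; rewrite Rabs_pos_eq; lra.
  - intros t _ Ht _ Hbelow.
    destruct (Hl t Ht) as [l Hlim].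
    destruct (proj1 (lim_along_iff _ _ _ _) Hlim eps Heps) as [d [Hd Hs]].
    assert (h1 := Rmin_l d (t - a)); assert (h2 := Rmin_r d (t - a)).
    assert (h3 : 0 < Rmin d (t - a)) by (apply Rmin_pos; lra).
    destruct (Hbelow (t - Rmin d (t - a) / 2) I) as [phi Hphi]; [lra|].
    apply (uniform_approx_extend f eps a (t - Rmin d (t - a) / 2) t l phi); auto; [lra|].
    intros y Hy; apply Hs; [lra|]; rewrite Rabs_left; lra.
Qed.

(** A function with one-sided limits everywhere is a uniform limit of step
    functions, hence Riemann integrable. *)
Lemma regulated_ex_RInt (f : R -> R) a b :
  a <= b ->
  (forall x, a <= x < b -> exists l, lim_along (fun y => x < y) x f l) ->
  (forall x, a < x <= b -> exists l, lim_along (fun y => y < x) x f l) ->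
  ex_RInt f a b.
Proof.
  intros Hab Hr Hl.
  assert (Hn : forall n : nat, exists phi, uniform_approx f (/ (INR n + 1)) a b phi).
  { intros n; apply regulated_uniform_approx; auto.
    apply Rinv_0_lt_compat; assert (h := pos_INR n); lra. }
  set (phi := fun n => proj1_sig (constructive_indefinite_description _ (Hn n))).
  assert (Hphi : forall n, uniform_approx f (/ (INR n + 1)) a b (phi n)).
  { intros n; exact (proj2_sig (constructive_indefinite_description _ (Hn n))). }
  (* Outside [a, b] the approximations are replaced by f itself, since uniform
     convergence is a matter of the whole line. *)
  set (psi := fun n y =>
    if Rle_dec a y then if Rle_dec y b then phi n y else f y else f y).
  destruct (filterlim_RInt (V := R_CompleteNormedModule) psi a b eventually
              eventually_filter f (fun n => RInt (psi n) a b)) as [If [_ HI]].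
  - intros n; apply (RInt_correct (V := R_CompleteNormedModule)).
    apply (ex_RInt_ext (phi n)); [|apply Hphi].
    intros y Hy; rewrite Rmin_left, Rmax_right in Hy by lra.
    unfold psi; destruct (Rle_dec a y); [|lra].
    destruct (Rle_dec y b); [reflexivity|lra].
  - apply (proj2 (filterlim_locally (U := fct_UniformSpace R R_UniformSpace)
                    psi f)); intros eps.
    destruct (nfloor_ex (/ eps)) as [N HN].
    { left; apply Rinv_0_lt_compat, cond_pos. }
    exists N; intros n Hn' y.
    assert (HNn : / (INR n + 1) < eps).
    { rewrite <- (Rinv_inv eps).
      apply Rinv_lt_contravar.
      - apply Rmult_lt_0_compat; [apply Rinv_0_lt_compat, cond_pos|].
        assert (h := pos_INR n); lra.
      - apply le_INR in Hn'; lra. }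
    change (Rabs (psi n y - f y) < eps); unfold psi.
    destruct (Rle_dec a y); [destruct (Rle_dec y b)|];
      try (rewrite Rminus_diag, Rabs_R0; apply cond_pos).
    apply Rlt_trans with (2 := HNn), Hphi; lra.
  - exists If; exact HI.
Qed.

(** * Antiderivatives of rd-continuous functions *)

(** What the integral up to [d] needs of its integrand: rd-continuity at the
    points before [d] and a left limit at [d], whatever the value at [d].  At
    left-scattered points the limit is taken along a set that does not accumulate
    there, so its existence is automatic; this makes the notion stable under
    algebra without case distinctions. *)
Definition rd_cont_upto (T : R -> Prop) (d : R) (g : R -> R) : Prop :=
  (forall t, T t -> t < d -> ts_sigma T t = t -> lim_along T t g (g t)) /\
  (forall t, T t -> t <= d ->
     exists l, lim_along (fun s => T s /\ s < t) t g l).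

Lemma rd_cont_upto_mono T d d' g :
  d' <= d -> rd_cont_upto T d g -> rd_cont_upto T d' g.
Proof.
  intros Hd [H1 H2]; split; intros t Tt Ht; [apply H1|apply H2]; auto; lra.
Qed.

Lemma rd_cont_upto_ext T d f g :
  (forall t, T t -> t < d -> f t = g t) -> rd_cont_upto T d f -> rd_cont_upto T d g.
Proof.
  intros Hfg [H1 H2]; split.
  - intros t Tt Ht Hs; rewrite <- (Hfg t Tt Ht).
    apply (lim_along_sub (fun s => T s /\ s < d)).
    { exists (mkposreal (d - t) ltac:(lra)); intros s Hb Ts; split; [exact Ts|].
      apply Rabs_def2 in Hb; unfold minus, plus, opp in Hb; simpl in Hb; lra. }
    apply (lim_along_ext _ _ f); [intros s [Ts Hsd]; auto|].
    apply (lim_along_subset T); [tauto|]; auto.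
  - intros t Tt Ht; destruct (H2 t Tt Ht) as [l Hl]; exists l.
    apply (lim_along_ext _ _ f); [|exact Hl].
    intros s [Ts Hst]; apply Hfg; [exact Ts|lra].
Qed.

Lemma rd_cont_upto_plus T d f g :
  rd_cont_upto T d f -> rd_cont_upto T d g -> rd_cont_upto T d (fun t => f t + g t).
Proof.
  intros [F1 F2] [G1 G2]; split.
  - intros; apply lim_along_plus; auto.
  - intros t Tt Ht; destruct (F2 t Tt Ht) as [l Hl]; destruct (G2 t Tt Ht) as [m Hm].
    exists (l + m); apply lim_along_plus; auto.
Qed.

Lemma rd_cont_upto_mult T d f g :
  rd_cont_upto T d f -> rd_cont_upto T d g -> rd_cont_upto T d (fun t => f t * g t).
Proof.
  intros [F1 F2] [G1 G2]; split.
  - intros; apply lim_along_mult; auto.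
  - intros t Tt Ht; destruct (F2 t Tt Ht) as [l Hl]; destruct (G2 t Tt Ht) as [m Hm].
    exists (l * m); apply lim_along_mult; auto.
Qed.

Lemma rd_cont_upto_comp T d f phi :
  (forall x, continuous phi x) ->
  rd_cont_upto T d f -> rd_cont_upto T d (fun t => phi (f t)).
Proof.
  intros Hphi [F1 F2]; split.
  - intros; apply lim_along_comp; auto.
  - intros t Tt Ht; destruct (F2 t Tt Ht) as [l Hl].
    exists (phi l); apply lim_along_comp; auto.
Qed.

Lemma rd_cont_upto_const T d c : rd_cont_upto T d (fun _ => c).
Proof.
  split; [intros; apply lim_along_const|].
  intros t _ _; exists c; apply lim_along_const.
Qed.

Lemma sigma_lt T a b t d :
  compact_ts T a b -> T t -> T d -> t < d -> ts_sigma T t <= d.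
Proof. intros HT Tt Td Htd; apply (sigma_spec T a b t HT Tt); auto. Qed.

(** If [d] is left-scattered, the points before [d] are those up to
    [ts_rho T d], and that last point is right-scattered, so that continuity
    there is not demanded from the right. *)
Lemma rd_cont_upto_rho T a b d g :
  compact_ts T a b -> T d -> continuous_on (ts_itv T a (ts_rho T d)) g ->
  rd_cont_upto T d g.
Proof.
  intros HT Td Hc.
  destruct (rho_spec T a b d HT Td) as [R1 [R2 R3]].
  assert (Hat : forall t, T t -> t <= ts_rho T d ->
            lim_along (fun s => T s /\ s <= ts_rho T d) t g (g t)).
  { intros t Tt Ht.
    apply (lim_along_subset (ts_itv T a (ts_rho T d))).
    - intros s [Ts Hs]; repeat split; auto; apply HT, Ts.
    - apply Hc; repeat split; auto; apply HT, Tt. }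
  split.
  - intros t Tt Htd Hs.
    assert (Htr : t < ts_rho T d).
    { destruct (right_dense_approx T a b t (d - t) HT Tt Hs) as [s [Ts Hst]];
        [apply Rlt_le_trans with d; auto; apply HT, Td|lra|].
      apply Rlt_le_trans with s; [lra|apply R3; auto; lra]. }
    apply (lim_along_sub (fun s => T s /\ s <= ts_rho T d)); [|apply Hat; auto; lra].
    exists (mkposreal (ts_rho T d - t) ltac:(lra)); intros s Hb Ts; split; [exact Ts|].
    apply Rabs_def2 in Hb; unfold minus, plus, opp in Hb; simpl in Hb; lra.
  - intros t Tt Htd; destruct (Rle_dec t (ts_rho T d)) as [h|h].
    + exists (g t).
      apply (lim_along_subset (fun s => T s /\ s <= ts_rho T d)); [|apply Hat; auto].
      intros s [Ts Hs]; split; [exact Ts|lra].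
    + exists 0; apply lim_along_iff; intros eps Heps.
      exists (t - ts_rho T d); split; [lra|]; intros s [Ts Hs] Hb.
      rewrite Rabs_left in Hb by lra.
      assert (s <= ts_rho T d) by (apply R3; auto; lra); lra.
Qed.

Lemma continuous_rd_cont_upto T a b d g :
  compact_ts T a b -> T d -> continuous_on (ts_itv T a d) g -> rd_cont_upto T d g.
Proof.
  intros HT Td Hc; apply (rd_cont_upto_rho T a b); auto.
  destruct (rho_spec T a b d HT Td) as [_ [R2 _]].
  intros t [Tt Ht].
  apply (lim_along_subset (ts_itv T a d)).
  - intros s [Ts Hs]; split; [exact Ts|lra].
  - apply Hc; split; [exact Tt|lra].
Qed.

(** Constant on the gaps of the time scale, so that its Riemann integral is the
    delta integral of [g].  The value [0] outside the interval makes it integrable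
    everywhere, hence its integral continuous everywhere. *)
Definition gap_extension (T : R -> Prop) (a d : R) (g : R -> R) (x : R) : R :=
  if Rle_dec a x then if Rlt_dec x d then g (ts_floor T x) else 0 else 0.

(** The extension is regulated: the floor of [y] tends to [x] from the same side
    as [y] where [x] is dense on that side, and is constant near [x] otherwise. *)
Lemma gap_extension_ex_RInt T a b d g :
  compact_ts T a b -> T d -> rd_cont_upto T d g ->
  ex_RInt (gap_extension T a d g) a d.
Proof.
  intros HT Td [HR HL].
  assert (Had : a <= d) by (apply HT, Td).
  assert (Hin : forall y, a <= y < d -> gap_extension T a d g y = g (ts_floor T y)).
  { intros y Hy; unfold gap_extension.
    destruct (Rle_dec a y); [|lra]; destruct (Rlt_dec y d); [reflexivity|lra]. }
  apply regulated_ex_RInt; [exact Had| |].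
  - intros x Hx; exists (g (ts_floor T x)).
    destruct (floor_spec T a b x HT (proj1 Hx)) as [F1 [F2 F3]].
    set (t := ts_floor T x) in *.
    destruct (classic (t = x /\ ts_sigma T t = t)) as [[E1 E2]|Hn].
    + assert (Hlim := HR t F1 ltac:(lra) E2).
      apply lim_along_iff; intros eps Heps.
      destruct (proj1 (lim_along_iff _ _ _ _) Hlim eps Heps) as [e [He Hs]].
      exists (Rmin e (d - x)); split; [apply Rmin_pos; lra|].
      intros y Hxy Hy.
      assert (h1 := Rmin_l e (d - x)); assert (h2 := Rmin_r e (d - x)).
      rewrite Rabs_pos_eq in Hy by lra.
      rewrite Hin by lra.
      destruct (floor_spec T a b y HT ltac:(lra)) as [G1 [G2 G3]].
      apply Hs; [exact G1|].
      assert (t <= ts_floor T y) by (apply G3; auto; lra).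
      rewrite Rabs_pos_eq; lra.
    + (* The floor is constant to the right of x. *)
      assert (Hgap : exists n, x < n /\ forall s, T s -> s < n -> s <= t).
      { destruct (sigma_spec T a b t HT F1) as [S1 [S2 S3]].
        exists (ts_sigma T t); split.
        - apply Rnot_le_lt; intros h.
          assert (h1 := F3 _ S1 h).
          assert (E : ts_sigma T t = t) by lra.
          apply Hn; split; [|exact E].
          destruct (Rle_lt_or_eq_dec t x F2) as [hl|he]; [exfalso|exact he].
          destruct (right_dense_approx T a b t (x - t) HT F1 E) as [s [Ts Hs]];
            [apply Rlt_le_trans with d; [lra|apply HT, Td]|lra|].
          assert (s <= t) by (apply F3; auto; lra); lra.
        - intros s Ts Hs; apply Rnot_lt_le; intros h.
          specialize (S3 s Ts h); lra. }
      destruct Hgap as [n [Hn1 Hn2]].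
      apply lim_along_iff; intros eps Heps.
      exists (Rmin (n - x) (d - x)); split; [apply Rmin_pos; lra|].
      intros y Hxy Hy.
      assert (h1 := Rmin_l (n - x) (d - x)); assert (h2 := Rmin_r (n - x) (d - x)).
      rewrite Rabs_pos_eq in Hy by lra.
      rewrite Hin by lra.
      rewrite (floor_unique T a b y t HT F1);
        [rewrite Rminus_diag, Rabs_R0; exact Heps|lra|].
      intros s Ts Hs; apply Hn2; auto; lra.
  - intros x Hx.
    destruct (classic (forall eps, 0 < eps -> exists s, T s /\ x - eps < s < x))
      as [Hdense|Hnd].
    + assert (Tx : T x).
      { apply closed_adherent; [apply HT|]; intros eps Heps.
        destruct (Hdense eps Heps) as [s [Ts Hs]]; exists s; split; [exact Ts|].
        rewrite Rabs_left; lra. }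
      destruct (HL x Tx (proj2 Hx)) as [l Hl]; exists l.
      apply lim_along_iff; intros eps Heps.
      destruct (proj1 (lim_along_iff _ _ _ _) Hl eps Heps) as [e [He Hs]].
      destruct (Hdense e He) as [s [Ts Hsx]].
      exists (x - s); split; [lra|]; intros y Hyx Hy.
      rewrite Rabs_left in Hy by lra.
      assert (Has : a <= s) by (apply HT, Ts).
      rewrite Hin by lra.
      destruct (floor_spec T a b y HT ltac:(lra)) as [G1 [G2 G3]].
      assert (s <= ts_floor T y) by (apply G3; auto; lra).
      apply Hs; [split; [exact G1|lra]|].
      rewrite Rabs_left; lra.
    + apply not_all_ex_not in Hnd; destruct Hnd as [e Hnd].
      apply imply_to_and in Hnd; destruct Hnd as [He Hnd].
      set (m := Rmax a (x - e / 2)).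
      assert (h1 := Rmax_l a (x - e / 2)); assert (h2 := Rmax_r a (x - e / 2)).
      assert (h3 : m < x) by (apply Rmax_lub_lt; lra).
      fold m in h1, h2.
      destruct (floor_spec T a b m HT h1) as [G1 [G2 G3]].
      exists (g (ts_floor T m)).
      apply lim_along_iff; intros eps Heps.
      exists (x - m); split; [lra|]; intros y Hyx Hy.
      rewrite Rabs_left in Hy by lra.
      rewrite Hin by lra.
      rewrite (floor_unique T a b y (ts_floor T m) HT G1);
        [rewrite Rminus_diag, Rabs_R0; exact Heps|lra|].
      intros s Ts Hs; apply G3; [exact Ts|].
      apply Rnot_lt_le; intros h; apply Hnd; exists s; split; [exact Ts|lra].
Qed.

Lemma gap_extension_ex_RInt_all T a b d g x y :
  compact_ts T a b -> T d -> rd_cont_upto T d g ->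
  ex_RInt (gap_extension T a d g) x y.
Proof.
  intros HT Td Hg.
  assert (Had : a <= d) by (apply HT, Td).
  assert (H : forall z, ex_RInt (gap_extension T a d g) a z).
  { assert (Hout : forall u v, u <= v -> v <= a \/ d <= u ->
              ex_RInt (gap_extension T a d g) u v).
    { intros u v Huv Hc; apply (ex_RInt_ext (fun _ => 0)); [|apply ex_RInt_const].
      intros z Hz; rewrite Rmin_left, Rmax_right in Hz by lra; unfold gap_extension.
      destruct (Rle_dec a z); [|reflexivity].
      destruct (Rlt_dec z d); [lra|reflexivity]. }
    assert (Hin := gap_extension_ex_RInt T a b d g HT Td Hg).
    intros z; destruct (Rle_dec z a) as [h|h].
    - apply ex_RInt_swap, Hout; lra.
    - destruct (Rle_dec z d) as [h'|h'].
      + apply (ex_RInt_Chasles_1 (V := R_CompleteNormedModule) _ a z d); [lra|exact Hin].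
      + apply ex_RInt_Chasles with d; [exact Hin|apply Hout; lra]. }
  apply ex_RInt_Chasles with a; [apply ex_RInt_swap|]; apply H.
Qed.

Lemma RInt_near_const (f : R -> R) s t c eps :
  0 <= eps -> ex_RInt f s t ->
  (forall x, Rmin s t < x < Rmax s t -> Rabs (f x - c) <= eps) ->
  Rabs (RInt f s t - c * (t - s)) <= eps * Rabs (t - s).
Proof.
  assert (Hle : forall s t, s <= t -> ex_RInt f s t ->
    (forall x, s < x < t -> Rabs (f x - c) <= eps) ->
    Rabs (RInt f s t - c * (t - s)) <= eps * Rabs (t - s)).
  { clear s t; intros s t Hst Hex Hf.
    assert (L : RInt (fun _ => c - eps) s t <= RInt f s t).
    { apply RInt_le; auto; [apply ex_RInt_const|].
      intros x Hx; specialize (Hf x Hx); apply Rabs_le_between in Hf; lra. }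
    assert (U : RInt f s t <= RInt (fun _ => c + eps) s t).
    { apply RInt_le; auto; [apply ex_RInt_const|].
      intros x Hx; specialize (Hf x Hx); apply Rabs_le_between in Hf; lra. }
    rewrite RInt_const in L, U; unfold scal in L, U; simpl in L, U.
    unfold mult in L, U; simpl in L, U.
    rewrite (Rabs_pos_eq (t - s)) by lra.
    apply Rabs_le; nra. }
  intros Heps Hex Hf; destruct (Rle_dec s t) as [h|h].
  - apply Hle; auto; rewrite Rmin_left, Rmax_right in Hf by lra; exact Hf.
  - assert (H := Hle t s ltac:(lra) (ex_RInt_swap _ _ _ Hex)).
    rewrite Rmin_right, Rmax_left in Hf by lra.
    specialize (H Hf).
    rewrite <- (opp_RInt_swap f t s (ex_RInt_swap _ _ _ Hex)).
    change (Rabs (- RInt f t s - c * (t - s)) <= eps * Rabs (t - s)).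
    rewrite <- Rabs_Ropp, (Rabs_minus_sym t s).
    replace (- (- RInt f t s - c * (t - s))) with (RInt f t s - c * (s - t)) by ring.
    exact H.
Qed.

(** The antiderivative is the Riemann integral of the gap extension.  The
    derivative at the maximum [b] is for the exponential function, whose equation
    is imposed on all of [kappa T]. *)
Lemma antiderivative_exists T a b d g :
  compact_ts T a b -> T d -> rd_cont_upto T d g ->
  exists F, (forall x, continuous F x) /\
    (forall t, T t -> t < d -> is_delta_derive T F t (g t)) /\
    (d = b -> lim_along T b g (g b) -> is_delta_derive T F b (g b)).
Proof.
  intros HT Td Hg.
  assert (Hex := fun x y => gap_extension_ex_RInt_all T a b d g x y HT Td Hg).
  set (G := gap_extension T a d g) in *.
  set (F := fun x => RInt G a x).
  assert (HF : forall x, continuous F x).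
  { intros x; apply (continuous_RInt_1 G a x F).
    apply filter_forall; intros z; apply (RInt_correct (V := R_CompleteNormedModule)), Hex. }
  assert (Hdiff : forall x y, F y - F x = RInt G x y).
  { intros x y; unfold F.
    rewrite <- (RInt_Chasles (V := R_CompleteNormedModule) G a x y) by apply Hex.
    unfold plus; simpl; ring. }
  assert (HcF : forall t, lim_along T t F (F t)).
  { intros t; apply (lim_along_comp T t (fun s => s) t F (HF t)), lim_along_id. }
  assert (Hdense : forall t, T t -> t <= d -> ts_sigma T t = t ->
            locally t (fun s => T s -> s <= d) -> lim_along T t g (g t) ->
            is_delta_derive T F t (g t)).
  { intros t Tt Htd Hs [r Hr] Hlim eps Heps; rewrite Hs.
    destruct (proj1 (lim_along_iff _ _ _ _) Hlim eps Heps) as [e [He Hse]].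
    exists (mkposreal (Rmin e r) (Rmin_pos _ _ He (cond_pos r))); intros s Hb Ts.
    assert (Hb' : Rabs (s - t) < Rmin e r) by exact Hb.
    assert (h1 := Rmin_l e r); assert (h2 := Rmin_r e r).
    assert (Hsd : s <= d) by (apply Hr; [|exact Ts]; apply Rlt_le_trans with (1 := Hb'); exact h2).
    rewrite Hdiff.
    apply RInt_near_const; [lra|apply Hex|].
    intros x Hx.
    assert (Has : a <= s) by (apply HT, Ts).
    assert (Hat : a <= t) by (apply HT, Tt).
    assert (Hax : a <= x /\ x < d).
    { revert Hx; unfold Rmin, Rmax; destruct (Rle_dec s t); lra. }
    assert (E : G x = g (ts_floor T x)).
    { unfold G, gap_extension; destruct (Rle_dec a x); [|lra].
      destruct (Rlt_dec x d); [reflexivity|lra]. }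
    rewrite E; left.
    destruct (floor_spec T a b x HT (proj1 Hax)) as [G1 [G2 G3]].
    apply Hse; [exact G1|].
    apply Rle_lt_trans with (Rabs (s - t)); [|lra].
    revert Hx; unfold Rmin, Rmax; destruct (Rle_dec s t) as [h|h]; intros Hx.
    - assert (s <= ts_floor T x) by (apply G3; auto; lra).
      rewrite !Rabs_left1; lra.
    - assert (t <= ts_floor T x) by (apply G3; auto; lra).
      rewrite !Rabs_pos_eq; lra. }
  exists F; split; [exact HF|split].
  - intros t Tt Htd.
    destruct (sigma_spec T a b t HT Tt) as [S1 [S2 S3]].
    destruct (Req_EM_T (ts_sigma T t) t) as [E|NE].
    + apply Hdense; auto; [lra| |apply Hg; auto].
      exists (mkposreal (d - t) ltac:(lra)); intros s Hb _.
      apply Rabs_def2 in Hb; unfold minus, plus, opp in Hb; simpl in Hb; lra.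
    + assert (Hsd : ts_sigma T t <= d) by (apply S3; auto).
      assert (Hat : a <= t) by (apply HT, Tt).
      replace (g t) with ((F (ts_sigma T t) - F t) / (ts_sigma T t - t)).
      { apply (delta_derive_scattered T a b); auto; lra. }
      rewrite Hdiff.
      assert (Hint : RInt G t (ts_sigma T t) = g t * (ts_sigma T t - t)).
      { rewrite (RInt_ext G (fun _ => g t)).
        - rewrite RInt_const; unfold scal; simpl; unfold mult; simpl; ring.
        - intros x Hx; rewrite Rmin_left, Rmax_right in Hx by lra.
          unfold G, gap_extension.
          destruct (Rle_dec a x); [|lra]; destruct (Rlt_dec x d); [|lra].
          f_equal; apply (floor_unique T a b); auto; [lra|].
          intros s Ts Hs; apply Rnot_lt_le; intros h.
          specialize (S3 s Ts h); lra. }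
      rewrite Hint; field; lra.
  - intros Hdb Hlim; apply Hdense; auto.
    + apply HT.
    + lra.
    + exact (sigma_max T a b HT).
    + apply filter_forall; intros s Ts; rewrite Hdb; apply HT, Ts.
Qed.

(** * The delta integral *)

Lemma antiderivative_iff T g c d F :
  c <= d ->
  is_delta_antiderivative T g c d F <->
  (forall t, T t -> c <= t < d -> is_delta_derive T F t (g t)) /\
  continuous_on (ts_itv T c d) F.
Proof.
  intros Hcd; unfold is_delta_antiderivative.
  rewrite Rmin_left, Rmax_right by lra; reflexivity.
Qed.

Lemma zero_derivative_constant T a b c d F :
  compact_ts T a b -> T c -> T d -> c <= d ->
  (forall t, T t -> c <= t < d -> is_delta_derive T F t 0) ->
  continuous_on (ts_itv T c d) F -> F c = F d.
Proof.
  intros HT Tc Td Hcd Hder Hc; apply Rle_antisym.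
  - apply (delta_derive_nonneg_le T a b F (fun _ => 0)); auto.
    intros t Tt Ht; split; [auto|lra].
  - apply Ropp_le_cancel.
    apply (delta_derive_nonneg_le T a b (fun t => - F t) (fun _ => 0)); auto.
    + intros t Tt Ht; split; [|lra].
      apply (delta_derive_ext_loc T (fun s => (-1) * F s)); try ring.
      * apply filter_forall; intros s _; ring.
      * replace 0 with ((-1) * 0) by ring.
        apply (delta_derive_scal T a b); auto.
    + intros t Ht; apply lim_along_opp, Hc, Ht.
Qed.

Lemma delta_int_eq T a b g c d F :
  compact_ts T a b -> T c -> T d -> c <= d ->
  (forall t, T t -> c <= t < d -> is_delta_derive T F t (g t)) ->
  continuous_on (ts_itv T c d) F ->
  delta_int T g c d = F d - F c.
Proof.
  intros HT Tc Td Hcd HF CF; unfold delta_int.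
  set (P := fun v => exists F, is_delta_antiderivative T g c d F /\ v = F d - F c).
  assert (HP : exists v, P v).
  { exists (F d - F c), F; split; [|reflexivity].
    apply antiderivative_iff; auto. }
  destruct (epsilon_spec (inhabits 0) P HP) as [F' [HF' E]].
  fold P; rewrite E.
  destruct (proj1 (antiderivative_iff T g c d F' Hcd) HF') as [DF' CF'].
  assert (H := zero_derivative_constant T a b c d (fun t => F' t - F t) HT Tc Td Hcd).
  enough (F' c - F c = F' d - F d) by lra.
  apply H.
  - intros t Tt Ht; replace 0 with (g t - g t) by ring.
    apply (delta_derive_minus T a b); auto.
  - intros t Ht; apply lim_along_minus; [apply CF'|apply CF]; exact Ht.
Qed.

(** An antiderivative exists, and any two differ by a constant. *)
Lemma delta_int_spec T a b d g :
  compact_ts T a b -> T d -> rd_cont_upto T d g ->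
  (forall t, T t -> t < d -> is_delta_derive T (fun t => delta_int T g a t) t (g t)) /\
  continuous_on (ts_itv T a d) (fun t => delta_int T g a t).
Proof.
  intros HT Td Hg.
  destruct (antiderivative_exists T a b d g HT Td Hg) as [F [CF [DF _]]].
  assert (HcF : forall D t, lim_along D t F (F t)).
  { intros D t; apply (lim_along_comp D t (fun s => s) t F (CF t)), lim_along_id. }
  assert (Ta : T a) by apply HT.
  assert (E : forall t, T t -> t <= d -> F t - F a = delta_int T g a t).
  { intros t Tt Ht; symmetry; apply (delta_int_eq T a b); auto.
    - apply HT, Tt.
    - intros s Ts Hs; apply DF; auto; lra.
    - intros s _; apply HcF. }
  split.
  - intros t Tt Ht.
    apply (delta_derive_ext_loc T (fun s => F s - F a)).
    + exists (mkposreal (d - t) ltac:(lra)); intros s Hb Ts; apply E; [exact Ts|].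
      apply Rabs_def2 in Hb; unfold minus, plus, opp in Hb; simpl in Hb; lra.
    + apply E; [apply (sigma_spec T a b t HT Tt)|].
      apply (sigma_lt T a b); auto.
    + replace (g t) with (g t - 0) by ring.
      apply (delta_derive_minus T a b); auto.
      apply (delta_derive_const T a b); auto.
  - intros t [Tt Ht].
    apply (lim_along_ext _ _ (fun s => F s - F a)).
    + intros s [Ts Hs]; apply E; [exact Ts|tauto].
    + rewrite <- E; [|exact Tt|tauto].
      apply lim_along_minus; [apply HcF|apply lim_along_const].
Qed.

Lemma delta_int_point T a b g : compact_ts T a b -> delta_int T g a a = 0.
Proof.
  intros HT; assert (Ta : T a) by apply HT.
  rewrite (delta_int_eq T a b g a a (fun _ => 0)); auto; [lra|lra| |].
  - intros; lra.
  - intros t _; apply filterlim_const.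
Qed.

Lemma delta_int_le T a b d f g :
  compact_ts T a b -> T d -> rd_cont_upto T d f -> rd_cont_upto T d g ->
  (forall t, T t -> t < d -> f t <= g t) ->
  delta_int T f a d <= delta_int T g a d.
Proof.
  intros HT Td Hf Hg Hfg.
  assert (Ta : T a) by apply HT; assert (Had : a <= d) by apply HT, Td.
  destruct (delta_int_spec T a b d f HT Td Hf) as [DF CF].
  destruct (delta_int_spec T a b d g HT Td Hg) as [DG CG].
  assert (H : delta_int T g a a - delta_int T f a a
              <= delta_int T g a d - delta_int T f a d).
  { apply (delta_derive_nonneg_le T a b
             (fun t => delta_int T g a t - delta_int T f a t)
             (fun t => g t - f t)); auto.
    - intros t Tt Ht; split.
      + apply (delta_derive_minus T a b); auto; [apply DG|apply DF]; auto; lra.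
      + specialize (Hfg t Tt); lra.
    - intros t Ht; apply lim_along_minus; [apply CG|apply CF]; exact Ht. }
  rewrite !(delta_int_point T a b) in H by exact HT; lra.
Qed.

Lemma delta_int_ext T a b d f g :
  compact_ts T a b -> T d -> rd_cont_upto T d f ->
  (forall t, T t -> t < d -> f t = g t) ->
  delta_int T f a d = delta_int T g a d.
Proof.
  intros HT Td Hf Hfg.
  assert (Hg : rd_cont_upto T d g) by (apply (rd_cont_upto_ext T d f); auto).
  apply Rle_antisym; apply (delta_int_le T a b); auto;
    intros t Tt Ht; rewrite Hfg; auto; lra.
Qed.

Lemma delta_int_plus T a b d f g :
  compact_ts T a b -> T d -> rd_cont_upto T d f -> rd_cont_upto T d g ->
  delta_int T (fun t => f t + g t) a d = delta_int T f a d + delta_int T g a d.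
Proof.
  intros HT Td Hf Hg.
  assert (Ta : T a) by apply HT; assert (Had : a <= d) by apply HT, Td.
  destruct (delta_int_spec T a b d f HT Td Hf) as [DF CF].
  destruct (delta_int_spec T a b d g HT Td Hg) as [DG CG].
  rewrite (delta_int_eq T a b _ a d
             (fun t => delta_int T f a t + delta_int T g a t)); auto.
  - rewrite !(delta_int_point T a b) by exact HT; ring.
  - intros t Tt Ht; apply (delta_derive_plus T a b); auto; [apply DF|apply DG]; auto; lra.
  - intros t Ht; apply lim_along_plus; [apply CF|apply CG]; exact Ht.
Qed.

Lemma delta_int_scal T a b d f c :
  compact_ts T a b -> T d -> rd_cont_upto T d f ->
  delta_int T (fun t => c * f t) a d = c * delta_int T f a d.
Proof.
  intros HT Td Hf.
  assert (Ta : T a) by apply HT; assert (Had : a <= d) by apply HT, Td.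
  destruct (delta_int_spec T a b d f HT Td Hf) as [DF CF].
  rewrite (delta_int_eq T a b _ a d (fun t => c * delta_int T f a t)); auto.
  - rewrite (delta_int_point T a b) by exact HT; ring.
  - intros t Tt Ht; apply (delta_derive_scal T a b); auto; apply DF; auto; lra.
  - intros t Ht; apply lim_along_mult; [apply lim_along_const|apply CF; exact Ht].
Qed.

Lemma delta_int_mono T a b d g s t :
  compact_ts T a b -> T d -> rd_cont_upto T d g ->
  (forall r, T r -> r < d -> 0 <= g r) ->
  T s -> T t -> s <= t -> t <= d ->
  delta_int T g a s <= delta_int T g a t.
Proof.
  intros HT Td Hg Hpos Ts Tt Hst Htd.
  destruct (delta_int_spec T a b d g HT Td Hg) as [DG CG].
  apply (delta_derive_nonneg_le T a b (fun t => delta_int T g a t) g); auto.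
  - intros r Tr Hr; split; [apply DG|apply Hpos]; auto; lra.
  - intros r [Tr Hr]; apply (lim_along_subset (ts_itv T a d)).
    + intros x [Tx Hx]; repeat split; auto; [apply HT, Tx|lra].
    + apply CG; repeat split; auto; [apply HT, Tr|lra].
Qed.

Lemma delta_int_nonneg T a b d g :
  compact_ts T a b -> T d -> rd_cont_upto T d g ->
  (forall r, T r -> r < d -> 0 <= g r) -> 0 <= delta_int T g a d.
Proof.
  intros HT Td Hg Hpos.
  rewrite <- (delta_int_point T a b g HT).
  apply (delta_int_mono T a b d); auto; try apply HT; auto; lra.
Qed.

(** * The exponential function *)

Lemma kappa_of_lt T a b t : compact_ts T a b -> T t -> t < b -> kappa T t.
Proof.
  intros [_ [_ [Tb _]]] Tt Htb; split; [exact Tt|].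
  intros [Hmax _]; specialize (Hmax b Tb); lra.
Qed.

(** Such a point is isolated. *)
Lemma lim_along_outside_kappa T a b t g :
  compact_ts T a b -> T t -> ~ kappa T t -> lim_along T t g (g t).
Proof.
  intros HT Tt Hk.
  assert (Hm : (forall s, T s -> s <= t) /\ ts_rho T t < t).
  { apply NNPP; intros h; apply Hk; split; auto. }
  destruct Hm as [Hmax Hr].
  destruct (rho_spec T a b t HT Tt) as [_ [_ R3]].
  apply lim_along_iff; intros eps Heps.
  exists (t - ts_rho T t); split; [lra|]; intros s Ts Hs.
  assert (E : s = t).
  { destruct (Rle_lt_or_eq_dec s t (Hmax s Ts)) as [h|h]; [exfalso|exact h].
    specialize (R3 s Ts h); rewrite Rabs_left in Hs; lra. }
  rewrite E, Rminus_diag, Rabs_R0; exact Heps.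
Qed.

Lemma graininess_lim_left T a b t :
  compact_ts T a b -> T t ->
  lim_along (fun s => T s /\ s < t) t (fun s => ts_sigma T s - s) 0.
Proof.
  intros HT Tt; apply lim_along_iff; intros eps Heps; exists eps; split; [exact Heps|].
  intros s [Ts Hst] Hs.
  destruct (sigma_spec T a b s HT Ts) as [_ [S2 S3]]; specialize (S3 t Tt Hst).
  rewrite Rabs_left in Hs by lra; rewrite Rabs_pos_eq; lra.
Qed.

Lemma graininess_lim T a b t :
  compact_ts T a b -> T t -> ts_sigma T t = t ->
  lim_along T t (fun s => ts_sigma T s - s) 0.
Proof.
  intros HT Tt E; apply lim_along_iff; intros eps Heps.
  destruct (proj1 (lim_along_iff _ _ _ _) (graininess_lim_left T a b t HT Tt) eps Heps)
    as [d [Hd Hl]].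
  assert (Hright : exists e, 0 < e /\ forall s, T s -> t < s < t + e ->
            Rabs (ts_sigma T s - s - 0) < eps).
  { destruct (Rle_lt_or_eq_dec t b) as [h|h]; [apply HT, Tt| |].
    - destruct (right_dense_approx T a b t eps HT Tt E h Heps) as [r [Tr Hr]].
      exists (r - t); split; [lra|]; intros s Ts Hs.
      destruct (sigma_spec T a b s HT Ts) as [_ [S2 S3]]; specialize (S3 r Tr).
      rewrite Rabs_pos_eq; lra.
    - exists 1; split; [lra|]; intros s Ts Hs.
      assert (s <= b) by (apply HT, Ts); lra. }
  destruct Hright as [e [He Hr]].
  exists (Rmin d e); split; [apply Rmin_pos; auto|]; intros s Ts Hs.
  assert (h1 := Rmin_l d e); assert (h2 := Rmin_r d e).
  destruct (Rtotal_order s t) as [h|[h|h]].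
  - apply Hl; [auto|lra].
  - rewrite h, E, !Rminus_diag, Rabs_R0; exact Heps.
  - apply Hr; [exact Ts|]; rewrite Rabs_pos_eq in Hs; lra.
Qed.

Lemma lim_along_squeeze D t f g h l :
  (forall s, D s -> Rabs (g s - f s) <= h s) ->
  lim_along D t f l -> lim_along D t h 0 -> lim_along D t g l.
Proof.
  intros Hb Hf Hh; apply lim_along_iff; intros eps Heps.
  destruct (proj1 (lim_along_iff _ _ _ _) Hf (eps / 2)) as [d [Hd Hs]]; [lra|].
  destruct (proj1 (lim_along_iff _ _ _ _) Hh (eps / 2)) as [e [He Hs']]; [lra|].
  exists (Rmin d e); split; [apply Rmin_pos; auto|]; intros s Ds Hst.
  assert (h1 := Rmin_l d e); assert (h2 := Rmin_r d e).
  specialize (Hs s Ds ltac:(lra)); specialize (Hs' s Ds ltac:(lra)).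
  specialize (Hb s Ds).
  replace (g s - l) with ((g s - f s) + (f s - l)) by ring.
  apply Rle_lt_trans with (1 := Rabs_triang _ _).
  rewrite Rminus_0_r in Hs'; apply Rabs_def2 in Hs'; lra.
Qed.

(** Hilger's cylinder transformation of [f]: the exponential of its delta integral
    picks up the factor [1 + mu f] across a gap of length [mu]. *)
Definition cylinder (T : R -> Prop) (f : R -> R) (t : R) : R :=
  if Req_EM_T (ts_sigma T t) t then f t
  else ln (1 + (ts_sigma T t - t) * f t) / (ts_sigma T t - t).

Lemma ln_le_pred y : 0 < y -> ln y <= y - 1.
Proof.
  intros Hy; assert (H := exp_ineq1_le (ln y)); rewrite exp_ln in H; lra.
Qed.

(** From [x - x^2 <= ln (1 + x) <= x] at [x = mu f]; in the limit [mu -> 0] it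
    makes the cylinder transformation of [f] as continuous as [f]. *)
Lemma cylinder_near T a b f t :
  compact_ts T a b -> T t -> (ts_sigma T t = t \/ 0 <= f t) ->
  Rabs (cylinder T f t - f t) <= (ts_sigma T t - t) * (f t * f t).
Proof.
  intros HT Tt Hf; unfold cylinder.
  destruct (sigma_spec T a b t HT Tt) as [_ [S2 _]].
  destruct (Req_EM_T (ts_sigma T t) t) as [e|ne].
  - rewrite e, !Rminus_diag, Rabs_R0; lra.
  - destruct Hf as [e|Hf]; [contradiction|].
    set (m := ts_sigma T t - t); assert (Hm : 0 < m) by (unfold m; lra).
    assert (Hx : 0 <= m * f t) by nra.
    set (x := m * f t) in *.
    assert (U := ln_le_pred (1 + x) ltac:(lra)).
    assert (L := ln_le_pred (/ (1 + x)) ltac:(apply Rinv_0_lt_compat; lra)).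
    rewrite ln_Rinv in L by lra.
    assert (L' : x - x * x <= ln (1 + x)).
    { apply Rle_trans with (1 - / (1 + x)); [|lra].
      apply (Rmult_le_reg_r (1 + x)); [lra|].
      replace ((1 - / (1 + x)) * (1 + x)) with x by (field; lra); nra. }
    replace (ln (1 + x) / m - f t) with ((ln (1 + x) - x) / m)
      by (unfold x; field; lra).
    unfold Rdiv; rewrite Rabs_mult, (Rabs_pos_eq (/ m))
      by (left; apply Rinv_0_lt_compat; exact Hm).
    apply (Rmult_le_reg_r m); [exact Hm|].
    rewrite Rmult_assoc, Rinv_l, Rmult_1_r by lra.
    replace (m * (f t * f t) * m) with (x * x) by (unfold x; ring).
    rewrite Rabs_left1; lra.
Qed.

Lemma cylinder_lim T a b f D t l :
  compact_ts T a b -> (forall s, D s -> T s) ->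
  (forall s, T s -> s < b -> 0 <= f s) ->
  lim_along D t (fun s => ts_sigma T s - s) 0 ->
  lim_along D t f l -> lim_along D t (cylinder T f) l.
Proof.
  intros HT HD Hf Hm Hl.
  apply (lim_along_squeeze D t f _ (fun s => (ts_sigma T s - s) * (f s * f s))); auto.
  - intros s Ds; apply (cylinder_near T a b); auto.
    destruct (Rle_lt_or_eq_dec s b) as [h|h]; [apply HT; auto|right; auto|left].
    rewrite h; apply (sigma_max T a b HT).
  - replace 0 with (0 * (l * l)) by ring.
    apply lim_along_mult; [exact Hm|]; apply lim_along_mult; exact Hl.
Qed.

Lemma cylinder_dense T f t : ts_sigma T t = t -> cylinder T f t = f t.
Proof.
  intros E; unfold cylinder; destruct (Req_EM_T (ts_sigma T t) t); congruence.
Qed.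

Definition is_delta_exp (T : R -> Prop) (a : R) (f E : R -> R) : Prop :=
  (forall t, 0 < E t) /\ E a = 1 /\
  (forall t, T t -> lim_along T t E (E t)) /\
  (forall t, kappa T t -> is_delta_derive T E t (f t * E t)).

(** The exponential of an antiderivative of the cylinder transformation. *)
Lemma delta_exp_exists T a b f :
  compact_ts T a b -> rd_cont_upto T b f ->
  (forall t, T t -> t < b -> 0 <= f t) ->
  (kappa T b -> lim_along T b f (f b)) ->
  exists E, is_delta_exp T a f E.
Proof.
  intros HT Hf Hpos Hfb.
  assert (Tb : T b) by apply HT.
  assert (Hq : rd_cont_upto T b (cylinder T f)).
  { split.
    - intros t Tt Htb E; rewrite cylinder_dense by exact E.
      apply (cylinder_lim T a b); auto; [apply (graininess_lim T a b); auto|].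
      apply Hf; auto.
    - intros t Tt Htb; destruct (proj2 Hf t Tt Htb) as [l Hl].
      exists l; apply (cylinder_lim T a b); auto; [tauto|].
      apply (graininess_lim_left T a b); auto. }
  destruct (antiderivative_exists T a b b _ HT Tb Hq) as [Q [CQ [DQ DQb]]].
  exists (fun t => exp (Q t - Q a)).
  assert (CQ' : forall t, lim_along T t (fun s => Q s - Q a) (Q t - Q a)).
  { intros t; apply lim_along_minus; [|apply lim_along_const].
    apply (lim_along_comp T t (fun s => s) t Q (CQ t)), lim_along_id. }
  split; [intros; apply exp_pos|].
  split; [rewrite Rminus_diag; apply exp_0|].
  split; [intros t Tt; apply lim_along_comp; auto using continuous_exp|].
  intros t Kt; assert (Tt : T t) by apply Kt.
  assert (DQt : is_delta_derive T Q t (cylinder T f t)).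
  { destruct (Rle_lt_or_eq_dec t b) as [h|h]; [apply HT, Tt|apply DQ; auto|].
    subst t; apply DQb; [reflexivity|].
    rewrite cylinder_dense by exact (sigma_max T a b HT).
    apply (cylinder_lim T a b); auto.
    apply (graininess_lim T a b); auto; exact (sigma_max T a b HT). }
  assert (D : is_delta_derive T (fun s => Q s - Q a) t (cylinder T f t)).
  { replace (cylinder T f t) with (cylinder T f t - 0) by ring.
    apply (delta_derive_minus T a b); auto; apply (delta_derive_const T a b); auto. }
  assert (Hs := delta_derive_sigma T a b _ t _ HT Tt D).
  set (F := fun s : R => Q s - Q a : R) in *.
  assert (DE := delta_derive_comp T a b F exp t _ _ HT Tt D
                  (is_derive_exp (F (ts_sigma T t))) (continuous_exp (F t))).
  change (is_delta_derive T (fun s => exp (F s)) t (f t * exp (F t))).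
  replace (f t * exp (F t))
    with (slope exp (exp (F (ts_sigma T t))) (F (ts_sigma T t)) (F t) * cylinder T f t);
    [exact DE|].
  destruct (Req_EM_T (ts_sigma T t) t) as [e|ne].
  - rewrite cylinder_dense, e by exact e.
    unfold slope; destruct (Req_EM_T (F t) (F t)); [ring|congruence].
  - destruct (sigma_spec T a b t HT Tt) as [S1 [S2 _]].
    assert (Htb : t < b) by (assert (ts_sigma T t <= b) by (apply HT, S1); lra).
    apply (Rmult_eq_reg_r (ts_sigma T t - t)); [|lra].
    rewrite Rmult_assoc.
    replace (cylinder T f t * (ts_sigma T t - t)) with (F (ts_sigma T t) - F t)
      by (simpl in Hs; lra).
    rewrite <- slope_eq.
    replace (F (ts_sigma T t))
      with (F t + ln (1 + (ts_sigma T t - t) * f t)).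
    + rewrite exp_plus, exp_ln; [ring|].
      specialize (Hpos t Tt Htb); nra.
    + simpl in Hs; rewrite Hs; unfold cylinder.
      destruct (Req_EM_T (ts_sigma T t) t); [contradiction|field; lra].
Qed.

(** Uniqueness: the quotient of a solution by [E] has derivative zero. *)
Lemma delta_exp_eq T a b f E t t0 :
  compact_ts T a b -> is_delta_exp T a f E -> T t -> T t0 ->
  delta_exp T f t t0 = E t / E t0.
Proof.
  intros HT [Epos [Ea [CE DE]]] Tt Tt0; unfold delta_exp.
  set (P := fun y : R -> R =>
    (forall s, kappa T s -> is_delta_derive T y s (f s * y s)) /\ y t0 = 1).
  assert (HP : exists y, P y).
  { exists (fun s => / E t0 * E s); split.
    - intros s Ks.
      replace (f s * (/ E t0 * E s)) with (/ E t0 * (f s * E s)) by ring.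
      apply (delta_derive_scal T a b); auto; apply Ks.
    - apply Rinv_l; specialize (Epos t0); lra. }
  destruct (epsilon_spec (inhabits (fun _ : R => 0)) P HP) as [Dy y0].
  set (y := epsilon (inhabits (fun _ : R => 0)) P) in *.
  assert (Cy : forall s, T s -> lim_along T s y (y s)).
  { intros s Ts; destruct (classic (kappa T s)) as [Ks|NK].
    - apply (delta_derive_cont T a b y s _ HT Ts (Dy s Ks)).
    - apply (lim_along_outside_kappa T a b); auto. }
  assert (Hconst : forall s, T s -> y a / E a = y s / E s).
  { intros s Ts.
    apply (zero_derivative_constant T a b a s (fun r => y r / E r)); auto.
    - apply HT.
    - apply HT, Ts.
    - intros r Tr Hr.
      assert (Kr : kappa T r).
      { apply (kappa_of_lt T a b); auto.
        assert (s <= b) by (apply HT, Ts); lra. }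
      replace 0 with ((f r * y r * E r - y r * (f r * E r)) / (E (ts_sigma T r) * E r)).
      + apply (delta_derive_div T a b); auto.
      + assert (h1 := Epos r); assert (h2 := Epos (ts_sigma T r)); field; lra.
    - intros r [Tr Hr].
      apply (lim_along_subset T); [intros x Hx; apply Hx|].
      apply lim_along_mult; [auto|].
      apply lim_along_inv; [specialize (Epos r); lra|auto]. }
  assert (H := eq_trans (eq_sym (Hconst t Tt)) (Hconst t0 Tt0)).
  rewrite y0 in H.
  assert (h1 := Epos t); assert (h2 := Epos t0).
  apply (Rmult_eq_reg_r (/ E t)); [|apply Rinv_neq_0_compat; lra].
  fold (y t / E t); rewrite H; field; lra.
Qed.

(** The integrand is the derivative of [s |-> - E t / E s]. *)
Lemma delta_int_exp T a b f E t :
  compact_ts T a b -> is_delta_exp T a f E -> T t ->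
  1 + delta_int T (fun s => f s * delta_exp T f t (ts_sigma T s)) a t = E t.
Proof.
  intros HT HE Tt; assert (HE' := HE); destruct HE' as [Epos [Ea [CE DE]]].
  rewrite (delta_int_eq T a b _ a t (fun s => (- E t) / E s)).
  - rewrite Ea; specialize (Epos t); field; lra.
  - exact HT.
  - apply HT.
  - exact Tt.
  - apply HT, Tt.
  - intros s Ts Hs.
    destruct (sigma_spec T a b s HT Ts) as [S1 _].
    rewrite (delta_exp_eq T a b f E) by auto.
    assert (Ks : kappa T s).
    { apply (kappa_of_lt T a b); auto; assert (t <= b) by (apply HT, Tt); lra. }
    assert (h1 := Epos s); assert (h2 := Epos (ts_sigma T s)).
    replace (f s * (E t / E (ts_sigma T s)))
      with ((0 * E s - (- E t) * (f s * E s)) / (E (ts_sigma T s) * E s)) by (field; lra).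
    apply (delta_derive_div T a b (fun _ => - E t) E); auto.
    apply (delta_derive_const T a b); auto.
  - intros s [Ts Hs].
    apply (lim_along_subset T); [intros x Hx; apply Hx|].
    apply lim_along_mult; [apply lim_along_const|].
    apply lim_along_inv; [specialize (Epos s); lra|auto].
Qed.

(** * Gauge functions and the Bihari transform *)

Definition gauge (g : R -> R) : Prop :=
  continuous_on (fun x => 0 <= x) g /\ (forall x, 0 <= x -> 0 <= g x) /\
  (forall x y, 0 <= x -> x <= y -> g x <= g y) /\ (forall x, 0 < x -> 0 < g x).

(** The even extension turns continuity on the half-line into continuity on the
    line, where limits compose without side conditions. *)
Lemma continuous_even_extension (g : R -> R) :
  continuous_on (fun x => 0 <= x) g -> forall x, continuous (fun y => g (Rabs y)) x.
Proof.
  intros Hg x.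
  apply (filterlim_comp _ _ _ Rabs g (locally x)
           (within (fun y => 0 <= y) (locally (Rabs x)))).
  - intros P HP; unfold within in HP.
    assert (H := continuous_Rabs x _ HP).
    unfold filtermap in *; revert H; apply filter_imp.
    intros y Hy; apply Hy, Rabs_pos.
  - apply Hg, Rabs_pos.
Qed.

Lemma rd_cont_upto_comp_nonneg T d f g :
  continuous_on (fun x => 0 <= x) g ->
  rd_cont_upto T d f -> (forall t, T t -> t < d -> 0 <= f t) ->
  rd_cont_upto T d (fun t => g (f t)).
Proof.
  intros Hg Hf Hpos.
  apply (rd_cont_upto_ext T d (fun t => g (Rabs (f t)))).
  - intros t Tt Ht; rewrite Rabs_pos_eq; auto.
  - apply (rd_cont_upto_comp T d f (fun y => g (Rabs y))); auto.
    apply continuous_even_extension, Hg.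
Qed.

Lemma Psi_kernel_pos Phi W x : gauge Phi -> gauge W -> 0 < x -> 0 < Phi (W x).
Proof.
  intros [_ [_ [_ HP]]] [_ [_ [_ HW]]] Hx; apply HP, HW, Hx.
Qed.

Lemma Psi_kernel_continuous Phi W x :
  gauge Phi -> gauge W -> 0 < x -> continuous (fun s => 1 / Phi (W s)) x.
Proof.
  intros HP HW Hx.
  assert (Hpos := Psi_kernel_pos Phi W x HP HW Hx).
  assert (Hc : continuous (fun s => Phi (Rabs (W (Rabs s)))) x).
  { apply (continuous_comp (fun s => W (Rabs s)) (fun y => Phi (Rabs y)));
      apply continuous_even_extension; [apply HW|apply HP]. }
  apply (continuous_ext_loc _ (fun s => / Phi (Rabs (W (Rabs s))))).
  - exists (mkposreal x Hx); intros s Hs.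
    assert (Hs' : Rabs (s - x) < x) by exact Hs.
    apply Rabs_def2 in Hs'.
    rewrite (Rabs_pos_eq s) by lra.
    rewrite (Rabs_pos_eq (W s)) by (apply HW; lra).
    unfold Rdiv; symmetry; apply Rmult_1_l.
  - apply (continuous_comp (fun s => Phi (Rabs (W (Rabs s)))) Rinv); [exact Hc|].
    rewrite (Rabs_pos_eq x) by lra.
    rewrite (Rabs_pos_eq (W x)) by (apply HW; lra).
    apply continuous_Rinv; lra.
Qed.

Lemma Psi_kernel_ex_RInt Phi W x y :
  gauge Phi -> gauge W -> 0 < x -> 0 < y -> ex_RInt (fun s => 1 / Phi (W s)) x y.
Proof.
  intros HP HW Hx Hy; apply (ex_RInt_continuous (V := R_CompleteNormedModule)).
  intros z Hz; apply Psi_kernel_continuous; auto.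
  revert Hz; unfold Rmin; destruct (Rle_dec x y); lra.
Qed.

Lemma Psi_diff Phi W x0 x y :
  gauge Phi -> gauge W -> 0 < x0 -> 0 < x -> 0 < y ->
  Psi Phi W x0 y - Psi Phi W x0 x = RInt (fun s => 1 / Phi (W s)) x y.
Proof.
  intros HP HW H0 Hx Hy; unfold Psi.
  rewrite <- (RInt_Chasles (V := R_CompleteNormedModule) _ x0 x y)
    by (apply Psi_kernel_ex_RInt; auto).
  unfold plus; simpl; ring.
Qed.

Lemma Psi_lt Phi W x0 x y :
  gauge Phi -> gauge W -> 0 < x0 -> 0 < x < y -> Psi Phi W x0 x < Psi Phi W x0 y.
Proof.
  intros HP HW H0 Hxy.
  assert (0 < Psi Phi W x0 y - Psi Phi W x0 x); [|lra].
  rewrite Psi_diff by (auto; lra).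
  apply RInt_gt_0; [lra| |].
  - intros z Hz; apply Rdiv_lt_0_compat; [lra|].
    apply Psi_kernel_pos; auto; lra.
  - intros z Hz; apply Psi_kernel_continuous; auto; lra.
Qed.

Lemma Psi_le_inv Phi W x0 x y :
  gauge Phi -> gauge W -> 0 < x0 -> 0 < x -> 0 < y ->
  Psi Phi W x0 x <= Psi Phi W x0 y -> x <= y.
Proof.
  intros HP HW H0 Hx Hy H; apply Rnot_lt_le; intros h.
  assert (Psi Phi W x0 y < Psi Phi W x0 x) by (apply Psi_lt; auto).
  lra.
Qed.

Lemma Psi_inv_spec Phi W x0 v :
  dom_Psi_inv Phi W x0 v ->
  0 < Psi_inv Phi W x0 v /\ Psi Phi W x0 (Psi_inv Phi W x0 v) = v.
Proof. exact (epsilon_spec (inhabits 0) _). Qed.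

Lemma Psi_derive Phi W x0 x :
  gauge Phi -> gauge W -> 0 < x0 -> 0 < x ->
  is_derive (Psi Phi W x0) x (1 / Phi (W x)).
Proof.
  intros HP HW H0 Hx.
  apply (is_derive_RInt (fun s => 1 / Phi (W s)) _ x0 x).
  - exists (mkposreal x Hx); intros y Hy.
    assert (Hy' : Rabs (y - x) < x) by exact Hy.
    apply Rabs_def2 in Hy'.
    apply (RInt_correct (V := R_CompleteNormedModule)), Psi_kernel_ex_RInt; auto; lra.
  - apply Psi_kernel_continuous; auto.
Qed.

Lemma Psi_continuous Phi W x0 x :
  gauge Phi -> gauge W -> 0 < x0 -> 0 < x -> continuous (Psi Phi W x0) x.
Proof.
  intros HP HW H0 Hx; apply (ex_derive_continuous (K := R_AbsRing) (V := R_NormedModule)).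
  exists (1 / Phi (W x)); apply Psi_derive; auto.
Qed.

(** The kernel is nonincreasing, so the mean slope of [Psi] over an interval is
    at most the kernel at its left end. *)
Lemma Psi_slope_le Phi W x0 x y :
  gauge Phi -> gauge W -> 0 < x0 -> 0 < x <= y ->
  slope (Psi Phi W x0) (1 / Phi (W y)) y x <= 1 / Phi (W x).
Proof.
  intros HP HW H0 Hxy; unfold slope; destruct (Req_EM_T x y) as [e|ne].
  - rewrite e; lra.
  - rewrite Psi_diff by (auto; lra).
    apply (Rmult_le_reg_r (y - x)); [lra|].
    unfold Rdiv at 1; rewrite Rmult_assoc, Rinv_l, Rmult_1_r by lra.
    replace (1 / Phi (W x) * (y - x)) with (RInt (fun _ => 1 / Phi (W x)) x y).
    + apply RInt_le; [lra|apply Psi_kernel_ex_RInt; auto; lra|apply ex_RInt_const|].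
      intros z Hz; unfold Rdiv; rewrite !Rmult_1_l.
      apply Rinv_le_contravar; [apply Psi_kernel_pos; auto; lra|].
      apply HP; [apply HW; lra|apply HW; lra].
    + rewrite RInt_const; unfold scal; simpl; unfold mult; simpl; ring.
Qed.

Lemma Psi_intermediate Phi W x0 x y v :
  gauge Phi -> gauge W -> 0 < x0 -> 0 < x <= y ->
  Psi Phi W x0 x <= v <= Psi Phi W x0 y -> dom_Psi_inv Phi W x0 v.
Proof.
  intros HP HW H0 Hxy Hv.
  destruct (Rle_lt_or_eq_dec x y (proj2 Hxy)) as [h|h].
  - destruct (f_interv_is_interv (Psi Phi W x0) x y v h Hv) as [z [Hz E]].
    + intros z Hz; apply continuity_pt_filterlim, Psi_continuous; auto; lra.
    + exists z; split; [lra|exact E].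
  - exists x; split; [lra|]; rewrite <- h in Hv; lra.
Qed.

(** [Psi] is strictly increasing, so its values at [x - e] and [x + e] enclose a
    neighbourhood of [Psi x]. *)
Lemma Psi_inv_continuous_on Phi W x0 (D : R -> Prop) (V : R -> R) :
  gauge Phi -> gauge W -> 0 < x0 ->
  (forall s, D s -> dom_Psi_inv Phi W x0 (V s)) -> continuous_on D V ->
  continuous_on D (fun s => Psi_inv Phi W x0 (V s)).
Proof.
  intros HP HW H0 Hdom HV t Dt.
  apply lim_along_iff; intros eps Heps.
  destruct (Psi_inv_spec Phi W x0 _ (Hdom t Dt)) as [Hx E].
  set (x := Psi_inv Phi W x0 (V t)) in *.
  set (e := Rmin (eps / 2) (x / 2)).
  assert (He : 0 < e) by (apply Rmin_pos; lra).
  assert (h1 : e <= eps / 2) by apply Rmin_l.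
  assert (h2 : e <= x / 2) by apply Rmin_r.
  assert (L : Psi Phi W x0 (x - e) < V t) by (rewrite <- E; apply Psi_lt; auto; lra).
  assert (U : V t < Psi Phi W x0 (x + e)) by (rewrite <- E; apply Psi_lt; auto; lra).
  set (r := Rmin (V t - Psi Phi W x0 (x - e)) (Psi Phi W x0 (x + e) - V t)).
  assert (Hr : 0 < r) by (apply Rmin_pos; lra).
  assert (r1 : r <= V t - Psi Phi W x0 (x - e)) by apply Rmin_l.
  assert (r2 : r <= Psi Phi W x0 (x + e) - V t) by apply Rmin_r.
  destruct (proj1 (lim_along_iff _ _ _ _) (HV t Dt) r Hr) as [d [Hd Hs]].
  exists d; split; [exact Hd|]; intros s Ds Hst.
  specialize (Hs s Ds Hst); apply Rabs_def2 in Hs.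
  destruct (Psi_inv_spec Phi W x0 _ (Hdom s Ds)) as [Hy Ey].
  set (y := Psi_inv Phi W x0 (V s)) in *.
  assert (x - e <= y) by (apply (Psi_le_inv Phi W x0); auto; lra).
  assert (y <= x + e) by (apply (Psi_le_inv Phi W x0); auto; lra).
  apply Rabs_def1; lra.
Qed.

(** * The inequalities of Gronwall and Bihari *)

(** The right-hand side of the hypothesis divided by [E] is nonincreasing, and its
    value at [a] is [n].  For a nondecreasing function in place of the constant
    [n], the lemma is applied with its value at [t]. *)
Lemma gronwall T a b f u n E t :
  compact_ts T a b -> is_delta_exp T a f E ->
  rd_cont_upto T b (fun s => f s * u s) ->
  (forall s, T s -> s < b -> 0 <= f s) -> T t ->
  (forall s, T s -> s <= t -> u s <= n + delta_int T (fun r => f r * u r) a s) ->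
  n + delta_int T (fun r => f r * u r) a t <= n * E t.
Proof.
  intros HT [Epos [Ea [CE DE]]] Hfu Hf Tt Hu.
  assert (Ta : T a) by apply HT.
  assert (Tb : T b) by apply HT.
  assert (Hat : a <= t <= b) by apply HT, Tt.
  destruct (delta_int_spec T a b b _ HT Tb Hfu) as [DI CI].
  set (I := fun s => delta_int T (fun r => f r * u r) a s) in *.
  set (y := fun s => (- n) - I s).
  assert (Dy : forall s, T s -> s < b -> is_delta_derive T y s (0 - f s * u s)).
  { intros s Ts Hs; apply (delta_derive_minus T a b (fun _ => - n)); auto.
    apply (delta_derive_const T a b); auto. }
  assert (H : y a / E a <= y t / E t).
  { apply (delta_derive_nonneg_le T a b (fun s => y s / E s)
      (fun s => ((0 - f s * u s) * E s - y s * (f s * E s)) / (E (ts_sigma T s) * E s)));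
      auto; [lra| |].
    - intros s Ts Hs; split.
      + apply (delta_derive_div T a b); auto; [apply Dy; auto; lra|].
        apply DE, (kappa_of_lt T a b); auto; lra.
      + assert (h1 := Epos s); assert (h2 := Epos (ts_sigma T s)).
        assert (h3 := Hf s Ts ltac:(lra)).
        assert (h4 := Hu s Ts ltac:(lra)).
        apply Rdiv_le_0_compat; [|apply Rmult_lt_0_compat; auto].
        unfold y; change (delta_int T (fun r => f r * u r) a s) with (I s) in h4.
        replace ((0 - f s * u s) * E s - (- n - I s) * (f s * E s))
          with ((f s * E s) * (n + I s - u s)) by ring.
        apply Rmult_le_pos; [apply Rmult_le_pos; lra|lra].
    - intros s [Ts Hs]; apply lim_along_mult.
      + apply lim_along_minus; [apply lim_along_const|].
        apply (lim_along_subset (ts_itv T a b)).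
        * intros r [Tr Hr]; split; [exact Tr|lra].
        * apply CI; split; [exact Ts|lra].
      + apply lim_along_inv; [specialize (Epos s); lra|].
        apply (lim_along_subset T); [intros r Hr; apply Hr|auto]. }
  unfold y, I in H; rewrite (delta_int_point T a b), Ea in H by exact HT.
  assert (h := Epos t).
  apply (Rmult_le_compat_r (E t)) in H; [|lra].
  set (J := delta_int T _ a t) in *.
  replace ((- n - J) / E t * E t) with (- n - J) in H by (field; lra).
  change (n + J <= n * E t); lra.
Qed.

(** With [r] the right-hand side of the integral inequality for [v], the chain rule
    and [v <= r] bound the derivative of [Psi (r t)] by [B t]; across a gap this
    uses that the kernel of [Psi] is nonincreasing. *)
Lemma bihari T a b d B v Phi W x0 xi :
  compact_ts T a b -> T d -> gauge Phi -> gauge W -> 0 < x0 -> 0 < xi ->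
  rd_cont_upto T d B -> (forall t, T t -> t < d -> 0 <= B t) ->
  rd_cont_upto T d (fun s => B s * Phi (W (v s))) ->
  (forall t, T t -> t <= d -> 0 <= v t) ->
  (forall t, T t -> t <= d ->
     v t <= xi + delta_int T (fun s => B s * Phi (W (v s))) a t) ->
  forall t x, T t -> t <= d -> 0 < x ->
    Psi Phi W x0 x = Psi Phi W x0 xi + delta_int T B a t -> v t <= x.
Proof.
  intros HT Td HP HW H0 Hxi HB Bpos HBv vpos Hv t x Tt Htd Hx Ex.
  assert (Ta : T a) by apply HT.
  assert (Hat : a <= t) by apply HT, Tt.
  assert (Gpos : forall s, T s -> s < d -> 0 <= B s * Phi (W (v s))).
  { intros s Ts Hs; apply Rmult_le_pos; [auto|].
    apply HP, HW, vpos; auto; lra. }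
  destruct (delta_int_spec T a b d _ HT Td HB) as [DB CB].
  destruct (delta_int_spec T a b d _ HT Td HBv) as [DG CG].
  set (r := fun s => xi + delta_int T (fun s => B s * Phi (W (v s))) a s).
  assert (rmono : forall s s', T s -> T s' -> s <= s' -> s' <= d -> r s <= r s').
  { intros; apply Rplus_le_compat_l, (delta_int_mono T a b d); auto. }
  assert (ra : r a = xi) by (unfold r; rewrite (delta_int_point T a b) by exact HT; ring).
  assert (rpos : forall s, T s -> s <= d -> 0 < r s).
  { intros s Ts Hs; apply Rlt_le_trans with (r a); [lra|].
    apply rmono; auto; apply HT, Ts. }
  assert (Dr : forall s, T s -> s < d -> is_delta_derive T r s (B s * Phi (W (v s)))).
  { intros s Ts Hs.
    rewrite <- (Rplus_0_l (B s * Phi (W (v s)))).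
    apply (delta_derive_plus T a b (fun _ => xi)); auto.
    apply (delta_derive_const T a b); auto. }
  assert (Cr : forall s, ts_itv T a t s -> lim_along (ts_itv T a t) s r (r s)).
  { intros s [Ts Hs]; apply lim_along_plus; [apply lim_along_const|].
    apply (lim_along_subset (ts_itv T a d)).
    - intros z [Tz Hz]; split; [exact Tz|lra].
    - apply CG; split; [exact Ts|lra]. }
  assert (Hle : v t <= r t) by (apply Hv; auto).
  apply Rle_trans with (1 := Hle).
  apply (Psi_le_inv Phi W x0); auto.
  rewrite Ex.
  assert (H : delta_int T B a a - Psi Phi W x0 (r a)
              <= delta_int T B a t - Psi Phi W x0 (r t)).
  { apply (delta_derive_nonneg_le T a b
      (fun s => delta_int T B a s - Psi Phi W x0 (r s))
      (fun s => B s - slope (Psi Phi W x0) (1 / Phi (W (r (ts_sigma T s))))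
                        (r (ts_sigma T s)) (r s) * (B s * Phi (W (v s))))); auto.
    - intros s Ts Hs.
      assert (Hsd : s < d) by lra.
      destruct (sigma_spec T a b s HT Ts) as [S1 [S2 S3]].
      assert (Hsig : ts_sigma T s <= d) by (apply S3; auto).
      split.
      + apply (delta_derive_minus T a b); auto.
        apply (delta_derive_comp T a b r (Psi Phi W x0)); auto.
        * apply Psi_derive; auto.
        * apply Psi_continuous; auto; apply rpos; auto; lra.
      + assert (Hslope := Psi_slope_le Phi W x0 (r s) (r (ts_sigma T s)) HP HW H0).
        assert (Hrs : 0 < r s) by (apply rpos; auto; lra).
        specialize (Hslope (conj Hrs (rmono s _ Ts S1 S2 Hsig))).
        assert (Hvs : v s <= r s) by (apply Hv; auto; lra).
        assert (Hv0 : 0 <= v s) by (apply vpos; auto; lra).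
        assert (HPW : Phi (W (v s)) <= Phi (W (r s))).
        { apply HP; [apply HW|apply HW]; auto. }
        assert (HPW0 : 0 <= Phi (W (v s))) by (apply HP, HW; auto).
        assert (Hk := Psi_kernel_pos Phi W (r s) HP HW Hrs).
        assert (HB0 := Bpos s Ts Hsd).
        set (m := slope _ _ _ _) in *.
        assert (Hm : m * Phi (W (v s)) <= 1).
        { apply Rle_trans with (1 / Phi (W (r s)) * Phi (W (v s))).
          - apply Rmult_le_compat_r; auto.
          - apply (Rmult_le_reg_r (Phi (W (r s)))); [exact Hk|].
            unfold Rdiv.
            replace (1 * / Phi (W (r s)) * Phi (W (v s)) * Phi (W (r s)))
              with (Phi (W (v s))) by (field; lra).
            lra. }
        replace (B s - m * (B s * Phi (W (v s))))
          with (B s * (1 - m * Phi (W (v s)))) by ring.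
        apply Rmult_le_pos; lra.
    - intros s Hs; apply lim_along_minus.
      + apply (lim_along_subset (ts_itv T a d)).
        * intros z [Tz Hz]; split; [exact Tz|lra].
        * apply CB; destruct Hs as [Ts Hs]; split; [exact Ts|lra].
      + apply lim_along_comp; [|apply Cr, Hs].
        apply Psi_continuous; auto; apply rpos; [apply Hs|].
        destruct Hs as [_ Hs]; lra. }
  rewrite (delta_int_point T a b), ra in H by exact HT; lra.
Qed.

(** * Domains of the data *)

Lemma rd_continuous_upto T D a b d g :
  compact_ts T a b -> T d -> rd_continuous T D g ->
  (forall t, T t -> t < d -> D t) -> (ts_rho T d = d -> D d) ->
  rd_cont_upto T d g.
Proof.
  intros HT Td Hg Hlt Hd; split.
  - intros t Tt Htd E.
    assert (H := proj1 (Hg t (Hlt t Tt Htd)) E).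
    apply (lim_along_sub D); [|exact H].
    exists (mkposreal (d - t) ltac:(lra)); intros s Hb Ts; apply Hlt; [exact Ts|].
    apply Rabs_def2 in Hb; unfold minus, plus, opp in Hb; simpl in Hb; lra.
  - intros t Tt Htd; destruct (Req_EM_T (ts_rho T t) t) as [e|ne].
    + assert (Dt : D t).
      { destruct (Rle_lt_or_eq_dec t d Htd) as [h|h]; [auto|].
        subst t; auto. }
      destruct (proj2 (Hg t Dt) e) as [l Hl]; exists l.
      apply (lim_along_subset (fun s => D s /\ s < t)); [|exact Hl].
      intros s [Ts Hs]; split; [apply Hlt; auto; lra|exact Hs].
    + destruct (rho_spec T a b t HT Tt) as [_ [R2 R3]].
      exists 0; apply lim_along_iff; intros eps Heps.
      exists (t - ts_rho T t); split; [lra|]; intros s [Ts Hs] Hb.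
      specialize (R3 s Ts Hs); rewrite Rabs_left in Hb; lra.
Qed.

Lemma kappa_of_left_dense T t : T t -> ts_rho T t = t -> kappa T t.
Proof. intros Tt E; split; [exact Tt|]; intros [_ h]; lra. Qed.

Lemma kappa_rho_max T a b : compact_ts T a b -> kappa T (ts_rho T b).
Proof.
  intros HT; assert (Tb : T b) by apply HT.
  destruct (rho_spec T a b b HT Tb) as [R1 [R2 _]].
  destruct (Rle_lt_or_eq_dec _ _ R2) as [h|h].
  - apply (kappa_of_lt T a b); auto.
  - rewrite h; apply kappa_of_left_dense; auto.
Qed.

Lemma kappa2_of_lt T a b t :
  compact_ts T a b -> T t -> t < ts_rho T b -> kappa (kappa T) t.
Proof.
  intros HT Tt Ht.
  destruct (rho_spec T a b b HT) as [_ [R2 _]]; [apply HT|].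
  split; [apply (kappa_of_lt T a b); auto; lra|].
  intros [Hmax _]; specialize (Hmax _ (kappa_rho_max T a b HT)); lra.
Qed.

(** The points of [kappa T] below [ts_rho T b] are those of [T], so left-density at
    that point is the same in both. *)
Lemma kappa2_rho_max T a b :
  compact_ts T a b -> ts_rho T (ts_rho T b) = ts_rho T b ->
  kappa (kappa T) (ts_rho T b).
Proof.
  intros HT E.
  destruct (rho_spec T a b b HT) as [R1 [R2 R3]]; [apply HT|].
  assert (Kd := kappa_rho_max T a b HT).
  assert (Hsame : forall s, kappa T s /\ s < ts_rho T b <-> T s /\ s < ts_rho T b).
  { intros s; split; intros [Hs Hlt]; split; auto; [apply Hs|].
    apply (kappa_of_lt T a b); auto; lra. }
  split; [exact Kd|]; intros [_ Hlt]; revert Hlt E.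
  set (d := ts_rho T b) in *; unfold ts_rho.
  destruct (excluded_middle_informative (exists s, kappa T s /\ s < d)) as [Hex|Hn].
  - destruct (excluded_middle_informative (exists s, T s /\ s < d)) as [Hex'|Hn'].
    + intros Hlt E.
      destruct (Lub_real _ d Hex) as [L1 L2]; [intros s Hs; lra|].
      destruct (Lub_real _ d Hex') as [K1 K2]; [intros s Hs; lra|].
      rewrite E in K2.
      assert (d <= real (Lub_Rbar (fun s => kappa T s /\ s < d))); [|lra].
      apply K2; intros s Hs; apply L1, Hsame, Hs.
    + destruct Hex as [s Hs]; exfalso; apply Hn'; exists s; apply Hsame, Hs.
  - intros Hlt _.
    assert (Hge : forall s, kappa T s -> d <= s).
    { intros s Ks; apply Rnot_lt_le; intros h; apply Hn; exists s; auto. }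
    destruct (Glb_real (kappa T) d (ex_intro _ d Kd) Hge) as [_ G2].
    specialize (G2 d Hge); lra.
Qed.

(** * The integral inequality *)

Lemma compact_ts_itv T a b :
  closed T -> T a -> T b -> a <= b -> compact_ts (ts_itv T a b) a b.
Proof.
  intros Hc Ta Tb Hab; split; [|split; [|split]].
  - apply (closed_and (T := R_UniformSpace) T (fun t => a <= t <= b)); [exact Hc|].
    apply (closed_and (T := R_UniformSpace) (fun t => a <= t) (fun t => t <= b));
      [apply closed_ge|apply closed_le].
  - split; [exact Ta|lra].
  - split; [exact Tb|lra].
  - intros t [_ Ht]; exact Ht.
Qed.

Lemma delta_int_zero_of_dominated T a b d g w K s :
  compact_ts T a b -> T d -> rd_cont_upto T d g -> rd_cont_upto T d w ->
  (forall t, T t -> t < d -> 0 <= g t <= K * w t) ->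
  delta_int T w a d = 0 -> T s -> s <= d -> delta_int T g a s = 0.
Proof.
  intros HT Td Hg Hw Hgw H0 Ts Hsd.
  assert (Hpos : forall t, T t -> t < d -> 0 <= g t) by (intros; apply Hgw; auto).
  apply Rle_antisym.
  - apply Rle_trans with (delta_int T g a d).
    + apply (delta_int_mono T a b d); auto; lra.
    + apply Rle_trans with (delta_int T (fun t => K * w t) a d).
      * apply (delta_int_le T a b); auto.
        -- apply rd_cont_upto_mult; auto using rd_cont_upto_const.
        -- intros t Tt Ht; apply Hgw; auto.
      * rewrite (delta_int_scal T a b), H0 by auto; lra.
  - apply (delta_int_nonneg T a b); auto.
    + apply (rd_cont_upto_mono T d); auto.
    + intros t Tt Ht; apply Hpos; auto; lra.
Qed.

Theorem theorem92
  (T : R -> Prop) (a b : R) (u f h afun bfun Phi W : R -> R) (x0 : R) :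
  time_scale T -> T a -> T b ->
  let Ts := ts_itv T a b in
  rd_continuous Ts Ts u ->
  (forall t, Ts t -> 0 <= u t) ->
  rd_continuous Ts (kappa Ts) f ->
  (forall t, kappa Ts t -> 0 <= f t) ->
  rd_continuous Ts (kappa Ts) h ->
  (forall t, kappa Ts t -> 0 <= h t) ->
  rd_continuous Ts (kappa (kappa Ts)) bfun ->
  (forall t, kappa (kappa Ts) t -> 0 <= bfun t) ->
  (exists t, kappa (kappa Ts) t /\ bfun t <> 0) ->
  continuous_on (fun x => 0 <= x) Phi ->
  (forall x, 0 <= x -> 0 <= Phi x) ->
  (forall x y, 0 <= x -> x <= y -> Phi x <= Phi y) ->
  (forall x y, 0 <= x -> 0 <= y -> Phi (x + y) <= Phi x + Phi y) ->
  (forall x y, 0 <= x -> 0 <= y -> Phi (x * y) <= Phi x * Phi y) ->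
  (forall x, 0 < x -> 0 < Phi x) ->
  continuous_on (fun x => 0 <= x) W ->
  (forall x, 0 <= x -> 0 <= W x) ->
  (forall x y, 0 <= x -> x <= y -> W x <= W y) ->
  (forall x, 0 < x -> 0 < W x) ->
  rd_continuous Ts Ts afun ->
  (forall t, Ts t -> 0 < afun t) ->
  (forall s t, Ts s -> Ts t -> s <= t -> afun s <= afun t) ->
  0 < x0 ->
  (forall t, Ts t ->
     u t <= afun t
            + delta_int Ts (fun s => f s * u s) a t
            + delta_int Ts (fun s =>
                f s * h s
                * W (delta_int Ts (fun tau => bfun tau * Phi (u tau)) a s)) a t) ->
  let p := fun t =>
    1 + delta_int Ts (fun s => f s * delta_exp Ts f t (ts_sigma Ts s)) a t in
  let xi := delta_int Ts (fun s => bfun s * Phi (p s * afun s)) a (ts_rho Ts b) in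
  let V := fun s =>
    Psi Phi W x0 xi
    + delta_int Ts (fun tau =>
        bfun tau * Phi (p tau)
        * Phi (delta_int Ts (fun theta => f theta * h theta) a tau)) a s in
  forall t, Ts t ->
    dom_Psi_inv Phi W x0 (V (ts_rho Ts t)) ->
    u t <= p t * afun t
           + p t * delta_int Ts (fun s =>
                     f s * h s * W (Psi_inv Phi W x0 (V s))) a t.
Proof.
  intros HT0 Ta0 Tb0 Ts; subst Ts.
  intros Hu0 Hupos Hf0 Hfpos0 Hh0 Hhpos0 Hb0 Hbpos0 _ CPhi Phi0 PhiM PhiA PhiMul PhiP
    CW W0 WM WP Ha0 Hapos Hamono Hx0 Hineq p xi V t Tt Hdom.
  assert (Hab : a <= b) by (destruct Tt as [_ h']; lra).
  set (S := ts_itv T a b) in *.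
  assert (HT : compact_ts S a b).
  { apply compact_ts_itv; auto; apply HT0. }
  clearbody S.
  assert (Ta : S a) by apply HT.
  assert (Tb : S b) by apply HT.
  assert (GPhi : gauge Phi) by (repeat split; auto).
  assert (GW : gauge W) by (repeat split; auto).
  set (d := ts_rho S b) in *.
  destruct (rho_spec S a b b HT Tb) as [Td [Hdb Hd]]; fold d in Td, Hdb, Hd.
  assert (Had : a <= d) by (apply HT, Td).
  assert (Ru : rd_cont_upto S b u) by (apply (rd_continuous_upto S S a b); auto).
  assert (Ra : rd_cont_upto S b afun) by (apply (rd_continuous_upto S S a b); auto).
  assert (Hk : forall s, S s -> s < b -> kappa S s).
  { intros; apply (kappa_of_lt S a b); auto. }
  assert (Hkb : ts_rho S b = b -> kappa S b) by (apply kappa_of_left_dense, Tb).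
  assert (Rf : rd_cont_upto S b f) by (apply (rd_continuous_upto S (kappa S) a b); auto).
  assert (Rh : rd_cont_upto S b h) by (apply (rd_continuous_upto S (kappa S) a b); auto).
  assert (Hk2 : forall s, S s -> s < d -> kappa (kappa S) s).
  { intros; apply (kappa2_of_lt S a b); auto. }
  assert (Rb : rd_cont_upto S d bfun).
  { apply (rd_continuous_upto S (kappa (kappa S)) a b); auto.
    apply (kappa2_rho_max S a b HT). }
  assert (Hfpos : forall s, S s -> s < b -> 0 <= f s) by auto.
  assert (Hhpos : forall s, S s -> s < b -> 0 <= h s) by auto.
  assert (Hbpos : forall s, S s -> s < d -> 0 <= bfun s) by auto.
  clear Hu0 Hfpos0 Hh0 Hhpos0 Hb0 Hbpos0 Ha0.
  destruct (delta_exp_exists S a b f HT Rf Hfpos) as [E HE].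
  { intros Kb; apply (lim_along_subset (kappa S)).
    - intros s Ts; destruct (Rle_lt_or_eq_dec s b) as [h'|h'];
        [apply HT, Ts|auto|rewrite h'; exact Kb].
    - apply Hf0; [exact Kb|exact (sigma_max S a b HT)]. }
  assert (Hp : forall s, S s -> p s = E s).
  { intros s Ts; apply (delta_int_exp S a b); auto. }
  clearbody p.
  assert (pa : p a = 1) by (rewrite Hp by auto; apply HE).
  assert (ppos : forall s, S s -> 0 < p s) by (intros; rewrite Hp by auto; apply HE).
  assert (Rp : rd_cont_upto S b p).
  { apply (rd_cont_upto_ext S b E); [intros; symmetry; auto|].
    apply (continuous_rd_cont_upto S a b); auto.
    intros s [Ts _]; apply (lim_along_subset S); [intros r Hr; apply Hr|].
    apply HE, Ts. }
  assert (pmono : forall r s, S r -> S s -> r <= s -> p r <= p s).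
  { intros r s Tr Ts Hrs; rewrite !Hp by auto.
    apply (delta_derive_nonneg_le S a b E (fun x => f x * E x)); auto.
    - intros x Tx Hx; assert (x < b) by (apply Rlt_le_trans with s; [lra|apply HT, Ts]).
      split; [apply HE; auto|].
      apply Rmult_le_pos; [auto|left; apply HE].
    - intros x [Tx _]; apply (lim_along_subset S); [intros y Hy; apply Hy|].
      apply HE, Tx. }
  set (v := fun s => delta_int S (fun tau => bfun tau * Phi (u tau)) a s) in *.
  set (z := fun s => delta_int S (fun s => f s * h s * W (v s)) a s).
  set (H := fun s => delta_int S (fun theta => f theta * h theta) a s) in *.
  assert (RPu : rd_cont_upto S d (fun s => Phi (u s))).
  { apply rd_cont_upto_comp_nonneg; auto; apply (rd_cont_upto_mono S b); auto. }
  assert (Rbu : rd_cont_upto S d (fun s => bfun s * Phi (u s))).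
  { apply rd_cont_upto_mult; auto. }
  assert (bupos : forall s, S s -> s < d -> 0 <= bfun s * Phi (u s)).
  { intros s Ts Hs; apply Rmult_le_pos; auto. }
  assert (Cv := proj2 (delta_int_spec S a b d _ HT Td Rbu)).
  change (continuous_on (ts_itv S a d) v) in Cv.
  assert (vpos : forall s, S s -> s <= d -> 0 <= v s).
  { intros s Ts Hs; apply (delta_int_nonneg S a b s); auto; [apply (rd_cont_upto_mono S d); auto|].
    intros r Tr Hr; apply bupos; auto; lra. }
  assert (vmono : forall r s, S r -> S s -> r <= s -> s <= d -> v r <= v s).
  { intros; apply (delta_int_mono S a b d); auto. }
  assert (RWv : rd_cont_upto S b (fun s => W (v s))).
  { apply rd_cont_upto_comp_nonneg; auto; apply (rd_cont_upto_rho S a b); auto. }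
  assert (Rfh : rd_cont_upto S b (fun s => f s * h s)) by (apply rd_cont_upto_mult; auto).
  assert (fhpos : forall s, S s -> s < b -> 0 <= f s * h s).
  { intros; apply Rmult_le_pos; auto. }
  assert (Rz : rd_cont_upto S b (fun s => f s * h s * W (v s))).
  { apply rd_cont_upto_mult; auto. }
  assert (fhWpos : forall s, S s -> s < b -> 0 <= f s * h s * W (v s)).
  { intros s Ts Hs; apply Rmult_le_pos; auto. }
  assert (zpos : forall s, S s -> 0 <= z s).
  { intros s Ts; assert (Hs : s <= b) by (apply HT, Ts).
    apply (delta_int_nonneg S a b s); auto; [apply (rd_cont_upto_mono S b); auto|].
    intros r Tr Hr; apply fhWpos; auto; lra. }
  assert (zmono : forall r s, S r -> S s -> r <= s -> z r <= z s).
  { intros r s Tr Ts Hrs; apply (delta_int_mono S a b b); auto; apply HT, Ts. }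
  assert (CH := proj2 (delta_int_spec S a b b _ HT Tb Rfh)).
  change (continuous_on (ts_itv S a b) H) in CH.
  assert (Hpos : forall s, S s -> 0 <= H s).
  { intros s Ts; assert (Hs : s <= b) by (apply HT, Ts).
    apply (delta_int_nonneg S a b s); auto; [apply (rd_cont_upto_mono S b); auto|].
    intros r Tr Hr; apply fhpos; auto; lra. }
  assert (Hmono : forall r s, S r -> S s -> r <= s -> H r <= H s).
  { intros r s Tr Ts Hrs; apply (delta_int_mono S a b b); auto; apply HT, Ts. }
  assert (RH : rd_cont_upto S b H) by (apply (continuous_rd_cont_upto S a b); auto).
  assert (Hu : forall s, S s -> u s <= p s * (afun s + z s)).
  { intros s Ts; rewrite Hp by auto.
    assert (G := gronwall S a b f u (afun s + z s) E s HT HE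
                   (rd_cont_upto_mult S b f u Rf Ru) Hfpos Ts).
    assert (G' := Hineq s Ts); fold (z s) in G'.
    rewrite (Rmult_comm (E s)).
    apply Rle_trans with (afun s + z s + delta_int S (fun r => f r * u r) a s); [lra|].
    apply G; intros r Tr Hrs.
    assert (Hr := Hineq r Tr); fold (z r) in Hr.
    assert (h1 := Hamono r s Tr Ts Hrs); assert (h2 := zmono r s Tr Ts Hrs); lra. }
  clear Hineq.
  set (B := fun tau => bfun tau * Phi (p tau) * Phi (H tau)) in *.
  set (w := fun s => bfun s * Phi (p s * afun s)) in *.
  assert (RB : rd_cont_upto S d B).
  { apply rd_cont_upto_mult; [apply rd_cont_upto_mult; auto|];
      apply (rd_cont_upto_mono S b); auto; apply rd_cont_upto_comp_nonneg; auto.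
    intros s Ts _; left; auto. }
  assert (Bpos : forall s, S s -> s < d -> 0 <= B s).
  { intros s Ts Hs; apply Rmult_le_pos; [apply Rmult_le_pos; auto|auto].
    apply Phi0; left; auto. }
  assert (papos : forall s, S s -> 0 <= p s * afun s).
  { intros s Ts; apply Rmult_le_pos; left; auto. }
  assert (Rw : rd_cont_upto S d w).
  { apply rd_cont_upto_mult; auto; apply (rd_cont_upto_mono S b); auto.
    apply rd_cont_upto_comp_nonneg; auto; apply rd_cont_upto_mult; auto. }
  assert (wpos : forall s, S s -> s < d -> 0 <= w s).
  { intros s Ts Hs; apply Rmult_le_pos; auto. }
  assert (RBW : rd_cont_upto S d (fun s => B s * Phi (W (v s)))).
  { apply rd_cont_upto_mult; auto.
    apply (rd_cont_upto_comp_nonneg S d (fun s => W (v s))); auto.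
    - apply (rd_cont_upto_mono S b); auto.
    - intros s Ts Hs; apply W0, vpos; auto; lra. }
  assert (xipos : 0 <= xi) by (apply (delta_int_nonneg S a b d w); auto).
  (* v is nondecreasing, so W (v s) can be taken out of the integral z s;
     submultiplicativity then separates the unknown from the data. *)
  assert (Hzv : forall s, S s -> s <= d -> Phi (z s) <= Phi (H s) * Phi (W (v s))).
  { intros s Ts Hs.
    apply Rle_trans with (Phi (H s * W (v s))); [|apply PhiMul; auto].
    apply PhiM; auto.
    rewrite Rmult_comm; unfold H; rewrite <- (delta_int_scal S a b) by
      (auto; apply (rd_cont_upto_mono S b); auto; lra).
    apply (delta_int_le S a b s); auto.
    - apply (rd_cont_upto_mono S b); auto; lra.
    - apply rd_cont_upto_mult; [apply rd_cont_upto_const|apply (rd_cont_upto_mono S b); auto; lra].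
    - intros r Tr Hr; rewrite (Rmult_comm (W (v s))).
      apply Rmult_le_compat_l; [apply fhpos; auto; lra|].
      apply WM; [apply vpos; auto; lra|apply vmono; auto; lra]. }
  assert (Hvxi : forall s, S s -> s <= d ->
            v s <= xi + delta_int S (fun s => B s * Phi (W (v s))) a s).
  { intros s Ts Hs.
    apply Rle_trans with (delta_int S (fun r => w r + B r * Phi (W (v r))) a s).
    - apply (delta_int_le S a b s); auto.
      + apply (rd_cont_upto_mono S d); auto.
      + apply (rd_cont_upto_mono S d); auto; apply rd_cont_upto_plus; auto.
      + intros r Tr Hr; unfold w, B.
        assert (Hrd : r < d) by lra.
        apply Rle_trans with
          (bfun r * (Phi (p r * afun r) + Phi (p r) * (Phi (H r) * Phi (W (v r)))));
          [|right; ring].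
        apply Rmult_le_compat_l; [auto|].
        apply Rle_trans with (Phi (p r * (afun r + z r))); [apply PhiM; auto|].
        rewrite Rmult_plus_distr_l.
        assert (pr := Rlt_le _ _ (ppos r Tr)).
        apply Rle_trans with (Phi (p r * afun r) + Phi (p r * z r)).
        * apply PhiA; auto; apply Rmult_le_pos; auto.
        * apply Rplus_le_compat_l.
          apply Rle_trans with (Phi (p r) * Phi (z r)); [apply PhiMul; auto|].
          apply Rmult_le_compat_l; [auto|apply Hzv; auto; lra].
    - rewrite (delta_int_plus S a b s w) by (auto; apply (rd_cont_upto_mono S d); auto).
      apply Rplus_le_compat_r.
      apply (delta_int_mono S a b d); auto; lra. }
  (* The integral up to t only sees the points up to rt, which is why the
     condition on the domain at rt suffices: V is nondecreasing. *)
  destruct (rho_spec S a b t HT Tt) as [Tr [Hrt Hr]].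
  set (rt := ts_rho S t) in *.
  assert (Htb : t <= b) by (apply HT, Tt).
  assert (Hrd : rt <= d).
  { destruct (Rle_lt_or_eq_dec t b Htb) as [h'|h'].
    - apply Rle_trans with (1 := Hrt), Hd; auto.
    - unfold rt, d; rewrite h'; lra. }
  assert (key : forall s, S s -> s <= rt ->
            dom_Psi_inv Phi W x0 (V s) /\ v s <= Psi_inv Phi W x0 (V s)).
  { intros s Ts Hs; destruct (Rle_lt_or_eq_dec 0 xi xipos) as [h'|h'].
    - assert (Hdom' : dom_Psi_inv Phi W x0 (V s)).
      { destruct (Psi_inv_spec Phi W x0 _ Hdom) as [Hx Ex].
        assert (L : Psi Phi W x0 xi <= V s).
        { assert (0 <= delta_int S B a s); [|unfold V; lra].
          apply (delta_int_nonneg S a b s); auto; [apply (rd_cont_upto_mono S d); auto; lra|].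
          intros r Tr' Hr'; apply Bpos; auto; lra. }
        assert (U : V s <= V rt).
        { apply Rplus_le_compat_l, (delta_int_mono S a b d); auto. }
        apply (Psi_intermediate Phi W x0 xi (Psi_inv Phi W x0 (V rt))); auto.
        - split; [exact h'|]; apply (Psi_le_inv Phi W x0); auto; lra.
        - lra. }
      split; [exact Hdom'|].
      destruct (Psi_inv_spec Phi W x0 _ Hdom') as [Hx Ex].
      apply (bihari S a b d B v Phi W x0 xi); auto; lra.
    - (* Here Psi xi is an integral down to 0, possibly divergent.  But bfun is
         then negligible: its integral against any bounded function is dominated
         by a multiple of xi, because Phi (p * afun) is bounded below by c.  So v
         vanishes and V is constant, with a value whose preimage under Psi is
         positive. *)
      set (c := Phi (afun a)).
      assert (cpos : 0 < c) by (apply PhiP; auto).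
      assert (Hcw : forall r, S r -> c <= Phi (p r * afun r)).
      { intros r Tr'; apply PhiM; [left; auto|].
        assert (Har : a <= r) by (apply HT, Tr').
        assert (h1 := pmono a r Ta Tr' Har); rewrite pa in h1.
        assert (h2 := Hamono a r Ta Tr' Har); assert (h3 := Hapos a Ta); nra. }
      assert (Hzero : forall g M, rd_cont_upto S d (fun r => bfun r * g r) ->
                (forall r, S r -> r < d -> 0 <= g r <= M) ->
                forall r, S r -> r <= d -> delta_int S (fun r => bfun r * g r) a r = 0).
      { intros g M Rg Hg r Tr' Hr'.
        apply (delta_int_zero_of_dominated S a b d _ w (M / c)); auto.
        intros q Tq Hq; destruct (Hg q Tq Hq) as [g0 g1].
        assert (b0 := Hbpos q Tq Hq).
        split; [apply Rmult_le_pos; auto|].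
        unfold w; replace (M / c * (bfun q * Phi (p q * afun q)))
          with (bfun q * (M * (Phi (p q * afun q) / c))) by (field; lra).
        apply Rmult_le_compat_l; [exact b0|].
        apply Rle_trans with (1 := g1).
        rewrite <- (Rmult_1_r M) at 1.
        apply Rmult_le_compat_l; [lra|].
        apply (Rmult_le_reg_r c); [exact cpos|].
        unfold Rdiv; rewrite Rmult_assoc, Rinv_l by lra.
        specialize (Hcw q Tq); lra. }
      assert (VB : forall r, S r -> r <= d -> delta_int S B a r = 0).
      { intros r Tr' Hr'.
        rewrite (delta_int_ext S a b r B (fun r => bfun r * (Phi (p r) * Phi (H r))));
          auto; [|apply (rd_cont_upto_mono S d); auto|intros; unfold B; ring].
        apply Hzero with (M := Phi (p b) * Phi (H b)); auto.
        - apply (rd_cont_upto_ext S d B); [intros; unfold B; ring|exact RB].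
        - intros q Tq Hq; assert (Hqb : q <= b) by lra.
          assert (pq := Rlt_le _ _ (ppos q Tq)).
          split; [apply Rmult_le_pos; auto|].
          apply Rmult_le_compat; auto. }
      assert (v0 : v s = 0).
      { apply Hzero with (M := Phi (p b * (afun b + z b))); auto; [|lra].
        intros q Tq Hq; assert (Hqb : q <= b) by lra; split; [auto|].
        apply PhiM; auto.
        apply Rle_trans with (1 := Hu q Tq).
        assert (h1 := Hapos q Tq); assert (h2 := zpos q Tq).
        apply Rmult_le_compat; auto; [left; auto|lra|].
        apply Rplus_le_compat; auto. }
      assert (EV : V s = V rt) by (unfold V; rewrite !VB; auto; lra).
      rewrite EV, v0; split; [exact Hdom|].
      left; apply (Psi_inv_spec Phi W x0 _ Hdom). }
  assert (CV : continuous_on (ts_itv S a rt) V).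
  { intros s [Ts Hs]; apply lim_along_plus; [apply lim_along_const|].
    apply (lim_along_subset (ts_itv S a d)).
    - intros r [Tr' Hr']; split; [exact Tr'|lra].
    - apply (proj2 (delta_int_spec S a b d B HT Td RB)); split; [exact Ts|lra]. }
  assert (RPsi : rd_cont_upto S t (fun s => W (Psi_inv Phi W x0 (V s)))).
  { apply rd_cont_upto_comp_nonneg; auto.
    - apply (rd_cont_upto_rho S a b); auto.
      apply Psi_inv_continuous_on; auto.
      intros s [Ts Hs]; apply key; [exact Ts|apply Hs].
    - intros s Ts Hs; left; apply Psi_inv_spec, key; auto. }
  apply Rle_trans with (1 := Hu t Tt).
  rewrite Rmult_plus_distr_l; apply Rplus_le_compat_l.
  apply Rmult_le_compat_l; [left; auto|].
  apply (delta_int_le S a b t); auto.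
  - apply (rd_cont_upto_mono S b); auto.
  - apply rd_cont_upto_mult; auto; apply (rd_cont_upto_mono S b); auto.
  - intros s Ts Hs; apply Rmult_le_compat_l; [apply fhpos; auto; lra|].
    assert (Hsr : s <= rt) by auto.
    apply WM; [apply vpos; auto; lra|apply key; auto].
Qed.
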